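(* Let $d\in\mathbb{N}$, $d\ge1$, let $\Omega\subset\mathbb{R}^d$ be open, and let $\rho\in\mathcal{S}(\mathbb{R}^d)$ be even with $\int\rho(x)\,dx=1$ and $\int x^m\rho(x)\,dx=0$ for all $m\in\mathbb{N}^d\setminus\{0\}$. Let $\iota_A,\iota_S,\iota_S':\mathcal{D}'(\Omega)\to\mathcal{G}(\Omega)$ be the three embeddings constructed (as described in the context) from this same $\rho$. Then $\iota_A=\iota_S=\iota_S'$.
   Context: **Colombeau algebra.** For an open set $U\subset\mathbb{R}^d$, a compact $K\Subset U$ and $l\in\mathbb{N}$, put $p_{K,l}(f)=\sup_{|\alpha|\le l,\,x\in K}|\partial^\alpha f(x)|$ for $f\in C^\infty(U)$ (complex-valued). Let $\mathcal{F}(C^\infty(U))$ be the set of nets $(f_\varepsilon)_\varepsilon\in C^\infty(U)^{(0,1]}$ such that for all $l\in\mathbb{N}$ and $K\Subset U$ there is $q\in\mathbb{N}$ with $p_{K,l}(f_\varepsilon)=o(\varepsilon^{-q})$ as $\varepsilon\to0$, and $\mathcal{N}(C^\infty(U))$ the set of nets such that for all $l\in\mathbb{N}$, $K\Subset U$ and $p\in\mathbb{N}$, $p_{K,l}(f_\varepsilon)=o(\varepsilon^{p})$ as $\varepsilon\to0$. Then $\mathcal{G}(U)=\mathcal{F}(C^\infty(U))/\mathcal{N}(C^\infty(U))$; $U\mapsto\mathcal{G}(U)$ is a sheaf of algebras on $\mathbb{R}^d$. **Mollifiers.** $\rho_\varepsilon(x)=\varepsilon^{-d}\rho(x/\varepsilon)$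 for $\varepsilon\in(0,1]$. Fix $\chi\in\mathcal{D}(\mathbb{R}^d)$ with $0\le\chi\le1$, $\chi\equiv1$ on $\overline{B(0,1)}$ and $\chi\equiv0$ on $\mathbb{R}^d\setminus B(0,2)$. Put $\theta_\varepsilon(x)=\rho_\varepsilon(x)\,\chi(x|\ln\varepsilon|)$ for $\varepsilon\in(0,1)$, and $\theta_1(x)=1$. **The embedding $\iota_A$.** Let $\iota_0:\mathcal{E}'(\mathbb{R}^d)\to\mathcal{G}(\mathbb{R}^d)$, $\iota_0(T)=(T*\rho_\varepsilon)_\varepsilon+\mathcal{N}(C^\infty(\mathbb{R}^d))$. Fix a locally finite open covering $(\Omega_\lambda)_{\lambda\in\Lambda}$ of $\Omega$ with each $\overline{\Omega}_\lambda$ compact and contained in $\Omega$, and functions $\psi_\lambda\in\mathcal{D}(\Omega)$ with $0\le\psi_\lambda\le1$ and $\psi_\lambda\equiv1$ on a neighborhood of $\overline{\Omega}_\lambda$. For $T\in\mathcal{D}'(\Omega)$, regard $\psi_\lambda T$ as an element of $\mathcal{E}'(\mathbb{R}^d)$. Then $\iota_A:\mathcal{D}'(\Omega)\to\mathcal{G}(\Omega)$ is the unique map with $\iota_A(T)|_{\Omega_\lambda}=\iota_0(\psi_\lambda T)|_{\Omega_\lambda}$ for all $\lambda\in\Lambda$ and all $T$ (these local pieces are coherent; $\iota_A$ is known not to depend on the choice of $(\Omega_\lambda)$ and $(\psi_\lambda)$). **The embedding $\iota_S$.** For $\varepsilon\in(0,1]$ let $K_\varepsilon=\{x\in\Omega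 : d(x,\mathbb{R}^d\setminus\Omega)\ge\varepsilon \text{ and } d(x,0)\le1/\varepsilon\}$ (the first condition being void if $\Omega=\mathbb{R}^d$). Choose $\kappa_\varepsilon\in\mathcal{D}(\Omega)$ with $0\le\kappa_\varepsilon\le1$ and $\kappa_\varepsilon\equiv1$ on $K_\varepsilon$. For $T\in\mathcal{D}'(\Omega)$, regard $\kappa_\varepsilon T$ as an element of $\mathcal{E}'(\mathbb{R}^d)$, and put $\iota_S(T)=\big(((\kappa_\varepsilon T)*\theta_\varepsilon)|_\Omega\big)_\varepsilon+\mathcal{N}(C^\infty(\Omega))$. **The embedding $\iota_S'$.** For an open set $\Omega'$ relatively compact in $\Omega$, choose $\varepsilon_{\Omega'}\in(0,1)$ such that $\operatorname{supp}\theta_\varepsilon(y-\cdot)\subset\Omega$ for all $y\in\Omega'$ and all $\varepsilon\in(0,\varepsilon_{\Omega'}^2]$. For $T\in\mathcal{D}'(\Omega)$ and $y\in\Omega'$ put $T_\varepsilon(y)=\langle T,\theta_\varepsilon(y-\cdot)\rangle$ for $\varepsilon\in(0,\varepsilon_{\Omega'}^2]$ and $T_\varepsilon(y)=T_{\varepsilon_{\Omega'}^2}(y)$ for $\varepsilon\in(\varepsilon_{\Omega'}^2,1]$, and let $\iota_{\Omega'}(T)=(T_\varepsilon)_\varepsilon+\mathcal{N}(C^\infty(\Omega'))\in\mathcal{G}(\Omega')$. With a locally finite open covering $(\Omega_\lambda)_{\lambda\in\Lambda}$ of $\Omega$ with each $\overline{\Omega}_\lambda$ compact and contained in $\Omega$,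 the family $(\iota_{\Omega_\lambda})_\lambda$ is coherent, and $\iota_S':\mathcal{D}'(\Omega)\to\mathcal{G}(\Omega)$ is the unique map with $\iota_S'(T)|_{\Omega_\lambda}=\iota_{\Omega_\lambda}(T)$ for all $\lambda\in\Lambda$ and all $T$ (it does not depend on the choice of covering). *)

(* Defs.v *)
From HB Require Import structures.
From mathcomp Require Import all_boot all_order all_algebra.
From mathcomp Require Import all_classical all_reals all_analysis.
From mathcomp Require Import complex.

Set Implicit Arguments.
Unset Strict Implicit.
Unset Printing Implicit Defensive.

Import Order.TTheory GRing.Theory Num.Theory.
Import numFieldNormedType.Exports.

Local Open Scope classical_set_scope.
Local Open Scope ring_scope.
Local Open Scope complex_scope.

(* Functions on an open set U are represented by total functions on R^d whose
   values off U are irrelevant.  The complex numbers R[i] are not a normed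
   space over R in the library, so differentiation and integration of complex
   functions are taken on real and imaginary parts. *)

Section Calculus.
Context {R : realType} {d : nat}.
Local Notation E := 'rV[R]_d.
Local Notation C := R[i].
Implicit Types (f : E -> C) (U K : set E) (x : E) (i : 'I_d).

Definition re_part f : E -> R := fun x => complex.Re (f x).
Definition im_part f : E -> R := fun x => complex.Im (f x).

Definition basis_vec i : E := delta_mx 0 i.

Definition cderivable f x i : Prop :=
  derivable (re_part f) x (basis_vec i) /\ derivable (im_part f) x (basis_vec i).

Definition ccontinuous_at f x : Prop :=
  {for x, continuous (re_part f)} /\ {for x, continuous (im_part f)}.

Definition cpartial i f : E -> C := fun x =>
  ('D_(basis_vec i) (re_part f) x) +i* ('D_(basis_vec i) (im_part f) x).

Definition cpartials (s : seq 'I_d) f : E -> C := foldr cpartial f s.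

Definition smooth U : set (E -> C) :=
  [set f | forall (s : seq 'I_d) x, U x ->
     (forall i, cderivable (cpartials s f) x i) /\
     ccontinuous_at (cpartials s f) x].

Definition multi_index := {ffun 'I_d -> nat}.

Definition mdeg (a : multi_index) : nat := (\sum_(i < d) a i)%N.

Definition mpartial (a : multi_index) f : E -> C :=
  cpartials (flatten [seq nseq (a i) i | i <- enum 'I_d]) f.

Definition monomial (a : multi_index) x : R := \prod_(i < d) x 0 i ^+ a i.

(* sup is 0 on the empty set, so the value is 0 for empty K *)
Definition seminorm K (l : nat) f : R :=
  sup [set r | exists a x, [/\ (mdeg a <= l)%N, K x
                            & r = Normc.normc (mpartial a f x)]].

Definition supp f : set E := closure [set x | f x != 0].

Definition testfun U : set (E -> C) :=
  [set f | [/\ smooth setT f, compact (supp f) & supp f `<=` U]].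

Definition schwartz : set (E -> C) :=
  [set f | smooth setT f /\
     forall a b : multi_index, exists M : R,
       forall x, `|monomial a x| * Normc.normc (mpartial b f x) <= M].

(* The library norm on 'rV is the sup norm. *)
Definition enorm x : R := Num.sqrt (\sum_(i < d) x 0 i ^+ 2).

(* +oo if A is empty *)
Definition edistance x (A : set E) : \bar R :=
  ereal_inf [set (enorm (x - y))%:E | y in A].

(* In the order of R[i], 0 <= z <= 1 forces z to be real. *)
Definition in01 f : Prop := forall x, 0 <= f x <= 1.

End Calculus.

Arguments multi_index : clear implicits.

(* Lebesgue integral over R^d as an iterated integral: the library has no
   d-dimensional Lebesgue measure, and for the rapidly decreasing integrands
   considered here the two agree by Fubini. *)
Fixpoint iterated_integral {R : realType} (d : nat) : ('rV[R]_d -> R) -> R :=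
  match d with
  | 0 => fun f => f 0
  | d'.+1 => fun f =>
      Rintegral (@lebesgue_measure R) setT (fun t : R =>
        iterated_integral (fun y : 'rV[R]_d' =>
          f (row_mx (const_mx t : 'rV[R]_1) y : 'rV[R]_(1 + d'))))
  end.

Definition cintegral {R : realType} {d : nat} (f : 'rV[R]_d -> R[i]) : R[i] :=
  iterated_integral (re_part f) +i* iterated_integral (im_part f).

Section Distributions.
Context {R : realType} {d : nat}.
Local Notation E := 'rV[R]_d.
Local Notation C := R[i].

(* Linear forms on test functions are extended by 0 to all functions, so that
   equality of distributions is equality of linear forms on testfun U. *)
Record schwartz_distribution (U : set E) := SchwartzDistribution {
  pairing :> (E -> C) -> C;
  _ : forall (c : C) (f g : E -> C), testfun U f -> testfun U g ->
        pairing (fun x => c * f x + g x) = c * pairing f + pairing g;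
  _ : forall K : set E, compact K -> K `<=` U ->
        exists (M : R) (l : nat), forall f : E -> C,
          testfun U f -> supp f `<=` K ->
          Normc.normc (pairing f) <= M * seminorm K l f;
  _ : forall f : E -> C, ~ testfun U f -> pairing f = 0 }.

(* psi T, for psi a test function on U, as a linear form on the smooth functions
   on R^d, i.e. as an element of E'(R^d): psi f is a test function on U for
   every smooth f. *)
Definition cutoff (U : set E) (psi : E -> C) (T : schwartz_distribution U) :
    (E -> C) -> C :=
  fun f => T (fun x => psi x * f x).

Definition convolution (S : (E -> C) -> C) (f : E -> C) : E -> C :=
  fun x => S (fun y => f (x - y)).

End Distributions.

Section Colombeau.
Context {R : realType} {d : nat}.
Local Notation E := 'rV[R]_d.
Local Notation C := R[i].
Implicit Types (U V : set E).

Local Notation zero_right := (at_right (0 : R)).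

(* Only the indices in ]0, 1] matter. *)
Definition net := R -> E -> C.
Implicit Types f g : net.

Definition smooth_net U f : Prop :=
  forall e : R, 0 < e <= 1 -> smooth U (f e).

Definition moderate U : set net :=
  [set f | smooth_net U f /\
     forall (l : nat) (K : set E), compact K -> K `<=` U ->
       exists q : nat,
         (fun e : R => seminorm K l (f e)) =o_zero_right (fun e : R => e ^- q)].

Definition negligible U : set net :=
  [set f | smooth_net U f /\
     forall (l : nat) (K : set E), compact K -> K `<=` U ->
       forall p : nat,
         (fun e : R => seminorm K l (f e)) =o_zero_right (fun e : R => e ^+ p)].

Definition coset U f : set net :=
  [set g | negligible U (fun e x => g e x - f e x)].

Record colombeau U := ColombeauElement {
  coset_of_elt :> set net;
  coset_of_eltP : exists2 f, moderate U f & coset_of_elt = coset U f }.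

HB.instance Definition _ U :=
  Choice.copy (colombeau U) {classic (colombeau U)}.

Definition net0 : net := fun _ _ => 0.

Lemma cpartials_0 (s : seq 'I_d) : cpartials s (fun _ : E => 0 : C) = fun=> 0.
Proof.
elim: s => //= i s ->; apply/funext => x; rewrite /cpartial.
rewrite (_ : re_part _ = cst 0)// (_ : im_part _ = cst 0)//.
by rewrite !derive_cst.
Qed.

Lemma seminorm_0 (K : set E) (l : nat) : seminorm K l (fun _ : E => 0 : C) = 0.
Proof.
rewrite /seminorm; set S := (X in sup X).
have S0 : S `<=` [set 0].
  move=> _ [a [x [_ _ ->]]]; rewrite /mpartial cpartials_0.
  exact: Normc.normc0.
by have [->|->] := subset_set1 S0; rewrite ?sup0 ?sup1.
Qed.

Lemma moderate_0 U : moderate U net0.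
Proof.
split.
  move=> e _ s x _; rewrite cpartials_0; split=> [i|]; split.
  - exact: derivable_cst.
  - exact: derivable_cst.
  - exact: cst_continuous.
  - exact: cst_continuous.
move=> l K _ _; exists 0%N.
apply/eqoP => c c0; apply: nearW => e.
rewrite [seminorm _ _ _]seminorm_0 normr0; apply: mulr_ge0.
  exact: ltW.
exact: normr_ge0.
Qed.

Definition colombeau0 U : colombeau U :=
  ColombeauElement (ex_intro2 _ _ net0 (moderate_0 U) erefl).

(* The class f + N, for f moderate; the nets it is applied to below are all
   moderate, so the default value 0 plays no role. *)
Definition colombeau_class U f : colombeau U :=
  xget (colombeau0 U) [set G : colombeau U | G = coset U f :> set net].

Definition representative U (G : colombeau U) : net :=
  s2val (cid2 (coset_of_eltP G)).

(* meaningful for V contained in U *)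
Definition colombeau_restr U V (G : colombeau U) : colombeau V :=
  colombeau_class V (representative G).

End Colombeau.

Arguments colombeau {R d} U.
Arguments colombeau_class {R d} U f.
Arguments colombeau_restr {R d U} V G.

Section Embeddings.
Context {R : realType} {d : nat}.
Local Notation E := 'rV[R]_d.
Local Notation C := R[i].
Variables (Omega : set E) (rho chi : E -> C).

Definition unit_mean_vanishing_moments : Prop :=
  cintegral rho = 1 /\
  forall m : multi_index d, m != [ffun=> 0%N] ->
    cintegral (fun x => (monomial m x)%:C * rho x) = 0.

Definition even_function : Prop := forall x, rho (- x) = rho x.

Definition plateau : Prop :=
  [/\ testfun setT chi, in01 chi,
      forall x, enorm x <= 1 -> chi x = 1 &
      forall x, 2 <= enorm x -> chi x = 0].

Definition rho_eps (e : R) : E -> C :=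
  fun x => (e ^- d)%:C * rho (e^-1 *: x).

Definition theta_eps (e : R) : E -> C :=
  fun x => if e == 1 then 1 else rho_eps e x * chi (`|ln e| *: x).

Definition relatively_compact_cover (L : Type) (W : L -> set E) : Prop :=
  [/\ forall l, open (W l),
      \bigcup_l W l = Omega,
      forall x, Omega x ->
        exists2 V, nbhs x V & finite_set [set l | W l `&` V !=set0] &
      forall l, compact (closure (W l)) /\ closure (W l) `<=` Omega].

(* S ranges over E'(R^d), seen as linear forms on smooth functions on R^d. *)
Definition iota_0 (S : (E -> C) -> C) : colombeau [set: E] :=
  colombeau_class setT (fun e => convolution S (rho_eps e)).

Definition cover_cutoffs (L : Type) (W : L -> set E) (psi : L -> E -> C) :
    Prop :=
  forall l, [/\ testfun Omega (psi l), in01 (psi l) &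
    exists V, [/\ open V, closure (W l) `<=` V &
                  forall x, V x -> psi l x = 1]].

(* The unique map with the prescribed restrictions; the default value of xget
   is irrelevant, since such a map exists. *)
Definition iota_A (L : Type) (W : L -> set E) (psi : L -> E -> C) :
    schwartz_distribution Omega -> colombeau Omega :=
  xget (fun=> colombeau0 Omega)
    [set iota : schwartz_distribution Omega -> colombeau Omega |
      forall l T, colombeau_restr (W l) (iota T) =
                  colombeau_restr (W l) (iota_0 (cutoff (psi l) T))].

Definition exhaustion (e : R) : set E :=
  [set x | [/\ Omega x, (e%:E <= edistance x (~` Omega))%E
             & enorm x <= e^-1]].

Definition exhaustion_cutoffs (kappa : R -> E -> C) : Prop :=
  forall e : R, 0 < e <= 1 ->
    [/\ testfun Omega (kappa e), in01 (kappa e) &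
        forall x, exhaustion e x -> kappa e x = 1].

Definition iota_S (kappa : R -> E -> C) (T : schwartz_distribution Omega) :
    colombeau Omega :=
  colombeau_class Omega (fun e => convolution (cutoff (kappa e) T) (theta_eps e)).

Definition admissible_eps (W : set E) (e0 : R) : Prop :=
  0 < e0 < 1 /\
  forall (y : E) (e : R), W y -> 0 < e <= e0 ^+ 2 ->
    supp (fun x => theta_eps e (y - x)) `<=` Omega.

Definition iota_local (W : set E) (e0 : R) (T : schwartz_distribution Omega) :
    colombeau W :=
  colombeau_class W (fun e => convolution T
           (theta_eps (if e <= e0 ^+ 2 then e else e0 ^+ 2))).

Definition iota_S' (L : Type) (W : L -> set E) (e0 : L -> R) :
    schwartz_distribution Omega -> colombeau Omega :=
  xget (fun=> colombeau0 Omega)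
    [set iota : schwartz_distribution Omega -> colombeau Omega |
      forall l T, colombeau_restr (W l) (iota T) = iota_local (W l) (e0 l) T].

End Embeddings.

Arguments iota_A {R d} Omega rho {L} W psi.
Arguments iota_S {R d} Omega rho chi kappa.
Arguments iota_S' {R d} Omega rho chi {L} W e0.

(* Main.v *)
Require Import Defs.
From mathcomp Require Import all_boot all_order all_algebra.
From mathcomp Require Import all_classical all_reals all_analysis.
From mathcomp Require Import complex.
From mathcomp Require Import ring lra.

Import Order.TTheory GRing.Theory Num.Theory.
Import numFieldNormedType.Exports.

Local Open Scope classical_set_scope.
Local Open Scope ring_scope.
Local Open Scope complex_scope.
Set Implicit Arguments.
Unset Strict Implicit.
Unset Printing Implicit Defensive.

(** All three embeddings regularize T by convolution with nearly the same mollifier,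
    and they differ in where T is cut off and in whether rho_e is truncated.  The truncated
    mollifier theta_e has its support in a ball of radius 2 / |ln e|, which shrinks to
    a point, so near a compact set K in Omega any two cutoffs that equal 1 around K give the
    same value of (k T) * theta_e once e is small; this value is also
    the pairing of T with theta_e(x - .).  Hence the nets
    defining iota_S and iota_S' are eventually equal around K
    (negligible_S_local).

    The nets of iota_A and iota_S differ around K by (k T) * (rho_e - theta_e)
    (theta_rho_difference).  The function rho_e - theta_e = rho_e (1 - chi(|ln e| .))
    lives where |z| is at least a constant times 1 / |ln e|, and there the argument
    z / e of rho is so large that rapid decay yields a factor (e |ln e|) ^ q for every q.
    This beats the powers of 1 / e and |ln e| that the scalings and the derivatives produce, so
    every derivative is O(e ^ p) for every p (mollifier_tail).  Since k T has finite
    order (distribution_bound), the same holds for the convolution, and the difference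
    is negligible.

    To turn this into equalities in the quotient, the nets must be smooth and moderate.
    Smoothness is differentiation under the pairing: a derivative of (k T) * g is
    (k T) * (derivative of g), by the same finite-order bound applied to
    difference quotients.  Derivatives then accumulate on g in arbitrary order,
    whereas decay is known for ordered multi-indices, so symmetry of second
    derivatives is needed (symmetry_second_derivative).  Finally iota_A and iota_S' are
    defined as the maps with prescribed restrictions to a cover; such a map is unique because
    negligibility is local (colombeau_separated), and iota_S has both families of
    restrictions. *)

(** * Directional derivatives of real functions *)

Section RealDirectional.
Context {R : realType} {E : normedModType R}.
Implicit Types (f : E -> R) (x v w : E).

Lemma is_derive_line f x v t df : is_derive (t *: v + x) v f df ->
  is_derive t (1 : R) (fun s : R => f (s *: v + x)) df.
Proof.
move=> [fd fdf].
have eqq : (fun h : R => h^-1 *: (f ((h *: (1 : R) + t) *: v + x) - f (t *: v + x)))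
  = (fun h => h^-1 *: (f (h *: v + (t *: v + x)) - f (t *: v + x))).
  by apply/funext => h; rewrite addrA -scalerDl [h *: _]mulr1.
by split; [rewrite /derivable|rewrite /derive]; rewrite /= eqq.
Qed.

(** Restricting to the line through x reduces this to the one-variable chain rule. *)
Lemma is_derive_affine f (c : R) x v w df : is_derive (c *: x + w) v f df ->
  is_derive x v (fun y => f (c *: y + w)) (c * df).
Proof.
move=> fdf.
have h1 : is_derive (c * 0) (1 : R) (fun s : R => f (s *: v + (c *: x + w))) df.
  by apply: is_derive_line; rewrite mulr0 scale0r add0r.
have h2 : is_derive (0 : R) (1 : R) (fun s : R => c * s) c.
  by apply: (is_derive_eq (@is_deriveZ R R R id c 0 1 1 _)); rewrite [_ *: _]mulr1.
have [h3 h4] := @is_derive1_comp _ _ _ _ _ _ h1 h2.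
have eqq : (fun h : R => h^-1 *: (f (c *: (h *: v + x) + w) - f (c *: x + w))) =
  (fun h : R => h^-1 *: (((fun s : R => f (s *: v + (c *: x + w))) \o
     (fun s : R => c * s)) (h *: (1 : R) + 0) -
     ((fun s : R => f (s *: v + (c *: x + w))) \o (fun s : R => c * s)) 0)).
  apply/funext => h /=.
  by rewrite mulr0 scale0r add0r addr0 [h *: 1]mulr1 [c *: (_ + x)]scalerDr scalerA addrA.
split; [rewrite /derivable|rewrite /derive]; rewrite /= eqq //.
by rewrite mulrC.
Qed.

Lemma derive_affine f (c : R) x v w : derivable f (c *: x + w) v ->
  'D_v (fun y => f (c *: y + w)) x = c * 'D_v f (c *: x + w).
Proof. by move=> /derivableP/is_derive_affine[]. Qed.

Lemma derivable_affine f (c : R) x v w : derivable f (c *: x + w) v ->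
  derivable (fun y => f (c *: y + w)) x v.
Proof. by move=> /derivableP/is_derive_affine[]. Qed.

(** Mean value theorem on a segment in direction v, for h of either sign; for h = 0
    the point xi = 0 works. *)
Lemma mean_value_line f x v (h : R) : (forall y, derivable f y v) ->
  exists2 xi : R, `|xi| <= `|h| & f (h *: v + x) - f x = h * 'D_v f (xi *: v + x).
Proof.
move=> fv.
have Hd (s : R) : is_derive s (1 : R) (fun s : R => f (s *: v + x)) ('D_v f (s *: v + x)).
  exact/is_derive_line/derivableP.
have Hc (a b : R) : {within `[a, b], continuous (fun s : R => f (s *: v + x))}.
  apply: continuous_subspaceT => s.
  apply: differentiable_continuous; apply/derivable1_diffP.
  exact: (@ex_derive _ _ _ _ _ _ _ (Hd s)).
have f0 : f x = f (0 *: v + x) by rewrite scale0r add0r.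
have [h0|h0|->] := ltgtP h 0; last first.
- by exists 0 => //; rewrite scale0r add0r subrr mul0r.
- have [xi] := @MVT _ _ (fun s => 'D_v f (s *: v + x)) 0 h h0 (fun s _ => Hd s) (Hc _ _).
  rewrite in_itv /= => /andP[x0 xh].
  rewrite -f0 subr0 mulrC => ->; exists xi => //.
  by rewrite !gtr0_norm// ltW.
- have [xi] := @MVT _ _ (fun s => 'D_v f (s *: v + x)) h 0 h0 (fun s _ => Hd s) (Hc _ _).
  rewrite in_itv /= => /andP[x0 xh].
  rewrite -f0 sub0r => e; exists xi => //.
    by rewrite !ltr0_norm// lerN2 ltW.
  by rewrite -opprB e mulrN opprK mulrC.
Qed.

(** Symmetry of second derivatives.  Applying the mean value theorem twice to the
    second difference of f over the parallelogram with sides h v and h w, in either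
    order, gives a value of each mixed derivative within O(h) of x; the two values
    agree, so continuity at x forces equality there. *)
Lemma symmetry_second_derivative f v w x :
  (forall y, derivable f y v) -> (forall y, derivable f y w) ->
  (forall y, derivable ('D_v f) y w) -> (forall y, derivable ('D_w f) y v) ->
  {for x, continuous ('D_w ('D_v f))} -> {for x, continuous ('D_v ('D_w f))} ->
  'D_w ('D_v f) x = 'D_v ('D_w f) x.
Proof.
have key v1 w1 (h : R) : (forall y, derivable f y v1) ->
    (forall y, derivable ('D_v1 f) y w1) ->
    exists a b : R, [/\ `|a| <= `|h|, `|b| <= `|h| &
      f (h *: v1 + (h *: w1 + x)) - f (h *: v1 + x) - f (h *: w1 + x) + f x =
      h * (h * 'D_w1 ('D_v1 f) (b *: w1 + (a *: v1 + x)))].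
  move=> fv fvw.
  pose g y := f (1 *: y + h *: w1) - f y.
  have gd y : derivable g y v1.
    by apply: derivableB => //; apply: derivable_affine; exact: fv.
  have [a a1 ea] := @mean_value_line g x v1 h gd.
  have [b b1 eb] := @mean_value_line ('D_v1 f) (a *: v1 + x) w1 h fvw.
  exists a, b; split => //.
  rewrite -eb.
  have -> : 'D_v1 f (h *: w1 + (a *: v1 + x)) - 'D_v1 f (a *: v1 + x)
     = 'D_v1 g (a *: v1 + x).
    rewrite [RHS]deriveB//; last by apply: derivable_affine; exact: fv.
    by rewrite derive_affine ?mul1r ?scale1r// [h *: _ + _]addrC.
  have H (p q r s : R) : p - q - r + s = p - q - (r - s) by rewrite opprB addrA addrAC.
  rewrite -ea H /g !scale1r; congr (f _ - _ - (f _ - _)); last exact: addrC.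
  by rewrite -addrA; congr (_ + _); exact: addrC.
move=> fv fw fvw fwv cvw cwv.
apply/eqP; rewrite -subr_eq0 -normr_le0; apply/ler_addgt0Pr => e e0; rewrite add0r.
have e20 : 0 < e / 2 by rewrite divr_gt0.
have /cvgr_dist_lt/(_ _ e20) := cvw.
move=> /nbhs_ballP[r1 /= r10 H1].
have /cvgr_dist_lt/(_ _ e20) := cwv.
move=> /nbhs_ballP[r2 /= r20 H2].
have [r [r0 rr1 rr2]] : exists r, [/\ 0 < r, r <= r1 & r <= r2].
  by exists (Num.min r1 r2); rewrite lt_min r10 r20 !ge_min !lexx orbT.
have [N eN0] : exists N, N = `|v| + `|w| + 1 by exists (`|v| + `|w| + 1).
have N0 : 0 < N by rewrite eN0 ltr_pwDr// addr_ge0.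
(* A step small enough for all points of the parallelogram to lie in the ball of
   radius r. *)
have [h h0 hNr] : exists2 h, 0 < h & h * N < r.
  exists (r / (2 * N)); first by rewrite divr_gt0// mulr_gt0.
  by rewrite invfM mulrA mulfVK ?gt_eqF// ltr_pdivrMr// mulr_natr mulr2n ltrDl.
have [a [b [a1 b1 e1]]] := key v w h fv fvw.
have [a' [b' [a1' b1' e1']]] := key w v h fw fwv.
have e3 : 'D_w ('D_v f) (b *: w + (a *: v + x)) = 'D_v ('D_w f) (b' *: v + (a' *: w + x)).
  have hn0 : h != 0 by rewrite gt_eqF.
  apply: (mulfI hn0 (mulfI hn0 _)).
  refine (etrans (esym e1) (etrans _ e1')).
  have -> : h *: v + (h *: w + x) = h *: w + (h *: v + x) by exact: addrCA.
  by congr (_ + _); rewrite -!addrA; congr (_ + _); exact: addrC.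
have near1 (p q : R) (v1 w1 : E) : `|v1| + `|w1| + 1 = N -> `|p| <= `|h| -> `|q| <= `|h| ->
    ball x r (p *: w1 + (q *: v1 + x)).
  move=> eN ph qh; rewrite -ball_normE /= addrA opprD [- _ - x]addrC addrA subrr add0r.
  rewrite normrN; apply: (le_lt_trans (ler_normD (p *: w1) (q *: v1))).
  rewrite (normrZ p w1) (normrZ q v1).
  have hN : `|h| * `|w1| + `|h| * `|v1| < r.
    rewrite (gtr0_norm h0) -mulrDr; apply: (lt_trans _ hNr).
    by rewrite (ltr_pM2l h0) -eN [ltLHS]addrC ltrDl.
  by apply: le_lt_trans hN; apply: lerD; apply: ler_wpM2r.
have l1 := H1 _ (le_ball rr1 (near1 b a v w (esym eN0) b1 a1)).
have Nwv : `|w| + `|v| + 1 = N by rewrite eN0 [`|w| + _]addrC.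
have l2 := H2 _ (le_ball rr2 (near1 b' a' w v Nwv b1' a1')).
move: l1 l2; rewrite /= e3; move: ('D_v ('D_w f) (b' *: v + _)) => M l1 l2.
apply: (le_trans (ler_distD M _ _)); rewrite [leRHS]splitr.
by apply: lerD; [exact: ltW l1|rewrite (distrC M); exact: ltW l2].
Qed.

End RealDirectional.

Section RealQuotients.
Context {R : realType} {E : normedModType R}.

(** A linear rate of convergence is what a bound on second derivatives provides. *)
Lemma is_derive_quotient_bound (f : E -> R) x v (D M : R) :
  (forall h : R, h != 0 -> `|h| <= 1 -> `|h^-1 * (f (h *: v + x) - f x) - D| <= M * `|h|) ->
  is_derive x v f D.
Proof.
move=> H.
have cv : (fun h : R => h^-1 *: (f (h *: v + x) - f x)) @ 0^' --> D.
  apply/cvgrPdist_le => e e0; rewrite /dnbhs; near_simpl.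
  pose r := Num.min 1 (e / (`|M| + 1)).
  have M0 : 0 < `|M| + 1 by rewrite ltr_wpDl.
  have r0 : 0 < r by rewrite lt_min ltr01 divr_gt0.
  apply/nbhs_ballP; exists r => //= h; rewrite -ball_normE /= sub0r normrN => hr hn0.
  have h1 : `|h| <= 1 by rewrite (le_trans (ltW hr))// /r ge_min lexx.
  have he : `|h| <= e / (`|M| + 1) by rewrite (le_trans (ltW hr))// /r ge_min lexx orbT.
  rewrite distrC (le_trans (H h hn0 h1))// (@le_trans _ _ ((`|M| + 1) * `|h|))//.
    by apply: ler_wpM2r => //; rewrite (le_trans (ler_norm _))// lerDl.
  by rewrite mulrC -ler_pdivlMr.
split; last exact: cvg_lim cv.
by apply/cvg_ex; exists D.
Unshelve. all: by end_near. Qed.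

(** Two uses of the mean value theorem, the second one for the derivative of f. *)
Lemma quotient_second_order (f : E -> R) x v (h M : R) :
  (forall y, derivable f y v) -> (forall y, derivable ('D_v f) y v) ->
  h != 0 -> `|h| <= 1 ->
  (forall t : R, `|t| <= 1 -> `|'D_v ('D_v f) (t *: v + x)| <= M) ->
  `|h^-1 * (f (h *: v + x) - f x) - 'D_v f x| <= M * `|h|.
Proof.
move=> fv fvv h0 h1 HM.
have [a ah ->] := mean_value_line x h fv.
rewrite mulKf//.
have [b ba ->] := mean_value_line x a fvv.
rewrite normrM mulrC; apply: ler_pM; rewrite ?normr_ge0//.
by apply: HM; rewrite (le_trans ba)// (le_trans ah).
Qed.

End RealQuotients.

(** * Partial derivatives of complex functions *)

Section ComplexPartials.
Context {R : realType} {d : nat}.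
Local Notation E := 'rV[R]_d.
Local Notation C := R[i].
Implicit Types (f g h : E -> C) (U K : set E) (x y w : E) (i j : 'I_d) (s t : seq 'I_d).
Local Notation normc := Normc.normc.
Local Notation Re := complex.Re.
Local Notation Im := complex.Im.

Lemma ReD (a b : C) : Re (a + b) = Re a + Re b. Proof. by case: a b => ? ? []. Qed.
Lemma ImD (a b : C) : Im (a + b) = Im a + Im b. Proof. by case: a b => ? ? []. Qed.
Lemma ReM (a b : C) : Re (a * b) = Re a * Re b - Im a * Im b.
Proof. by case: a b => ? ? []. Qed.
Lemma ImM (a b : C) : Im (a * b) = Re a * Im b + Im a * Re b.
Proof. by case: a b => ? ? []. Qed.

Lemma eq_complexP (a b : C) : Re a = Re b -> Im a = Im b -> a = b.
Proof. by case: a b => ? ? [? ?] /= -> ->. Qed.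

Lemma re_partD f g : re_part (fun x => f x + g x) = re_part f + re_part g.
Proof. by apply/funext => x; rewrite /re_part ReD. Qed.
Lemma im_partD f g : im_part (fun x => f x + g x) = im_part f + im_part g.
Proof. by apply/funext => x; rewrite /im_part ImD. Qed.
Lemma re_partM f g : re_part (fun x => f x * g x) =
  re_part f * re_part g - im_part f * im_part g.
Proof. by apply/funext => x; rewrite /re_part ReM. Qed.
Lemma im_partM f g : im_part (fun x => f x * g x) =
  re_part f * im_part g + im_part f * re_part g.
Proof. by apply/funext => x; rewrite /im_part ImM. Qed.

(** The analogue of is_derive for a complex function: computing a partial derivative
    and proving that it exists become a single goal. *)
Definition is_cpartial f x i (D : C) : Prop :=
  is_derive x (basis_vec i) (re_part f) (Re D) /\
  is_derive x (basis_vec i) (im_part f) (Im D).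

Lemma cderivableP f x i : cderivable f x i -> is_cpartial f x i (cpartial i f x).
Proof. by case=> /derivableP ? /derivableP ?. Qed.

Lemma is_cpartialE f x i D : is_cpartial f x i D -> cpartial i f x = D.
Proof. by case=> -[_ d1] [_ d2]; apply: eq_complexP. Qed.

Lemma is_cpartial_derivable f x i D : is_cpartial f x i D -> cderivable f x i.
Proof. by case=> -[? _] [? _]. Qed.

Lemma is_cpartial_cst (c : C) x i : is_cpartial (fun=> c) x i 0.
Proof. by split; exact: is_derive_cst. Qed.

Lemma is_cpartialD f g x i D D' : is_cpartial f x i D -> is_cpartial g x i D' ->
  is_cpartial (fun x => f x + g x) x i (D + D').
Proof.
move=> [d1 d2] [d3 d4]; split.
  by rewrite re_partD ReD; exact: is_deriveD.
by rewrite im_partD ImD; exact: is_deriveD.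
Qed.

Lemma is_cpartialM f g x i D D' : is_cpartial f x i D -> is_cpartial g x i D' ->
  is_cpartial (fun x => f x * g x) x i (D * g x + f x * D').
Proof.
move=> [d1 d2] [d3 d4].
have scE (a b : R) : a *: b = a * b by [].
split.
- rewrite re_partM; apply: (is_derive_eq (is_deriveB (is_deriveM d1 d3) (is_deriveM d2 d4))).
  rewrite ReD !ReM /re_part /im_part.
  rewrite !scE; ring.
- rewrite im_partM; apply: (is_derive_eq (is_deriveD (is_deriveM d1 d4) (is_deriveM d2 d3))).
  rewrite ImD !ImM /re_part /im_part.
  rewrite !scE; ring.
Qed.

Lemma is_cpartial_affine f (c : R) x w i D : is_cpartial f (c *: x + w) i D ->
  is_cpartial (fun y => f (c *: y + w)) x i (c%:C * D).
Proof.
move=> [d1 d2]; split.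
  by rewrite ReM /= mul0r subr0; exact: (is_derive_affine d1).
by rewrite ImM /= mul0r addr0; exact: (is_derive_affine d2).
Qed.

Lemma near_is_cpartial f g x i D : (\near x, f x = g x) ->
  is_cpartial f x i D -> is_cpartial g x i D.
Proof.
move=> fg [d1 d2]; split.
  by apply: near_eq_is_derive d1; apply: filterS fg => y; rewrite /re_part => ->.
by apply: near_eq_is_derive d2; apply: filterS fg => y; rewrite /im_part => ->.
Qed.

Lemma near_cpartial f g x i : (\near x, f x = g x) -> cpartial i f x = cpartial i g x.
Proof.
move=> fg; apply: eq_complexP; apply: near_eq_derive; apply: filterS fg => y;
by rewrite /re_part /im_part => ->.
Qed.

Lemma ccontinuous_cst (c : C) x : ccontinuous_at (fun=> c) x.
Proof. by split; exact: cst_continuous. Qed.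

Lemma ccontinuousD f g x : ccontinuous_at f x -> ccontinuous_at g x ->
  ccontinuous_at (fun x => f x + g x) x.
Proof.
move=> [f1 f2] [g1 g2]; split.
  by rewrite re_partD; exact: continuousD.
by rewrite im_partD; exact: continuousD.
Qed.

Lemma ccontinuousM f g x : ccontinuous_at f x -> ccontinuous_at g x ->
  ccontinuous_at (fun x => f x * g x) x.
Proof.
move=> [f1 f2] [g1 g2]; split.
  by rewrite re_partM; apply: continuousB; exact: continuousM.
by rewrite im_partM; apply: continuousD; exact: continuousM.
Qed.

Lemma ccontinuous_comp f (u : E -> E) x : {for x, continuous u} ->
  ccontinuous_at f (u x) -> ccontinuous_at (f \o u) x.
Proof.
move=> cu [f1 f2]; split.
  by apply: (@continuous_comp _ _ _ u (re_part f)).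
by apply: (@continuous_comp _ _ _ u (im_part f)).
Qed.

Lemma near_ccontinuous f g x : (\near x, f x = g x) ->
  ccontinuous_at f x -> ccontinuous_at g x.
Proof.
move=> fg; have fgx := nbhs_singleton fg.
move=> [f1 f2]; split; rewrite /prop_for /continuous_at /re_part /im_part -fgx.
  have e1 : {near x, re_part f =1 re_part g}.
    by apply: filterS fg => y; rewrite /re_part => ->.
  exact: cvg_trans (near_eq_cvg e1) f1.
have e2 : {near x, im_part f =1 im_part g}.
  by apply: filterS fg => y; rewrite /im_part => ->.
exact: cvg_trans (near_eq_cvg e2) f2.
Qed.

Lemma cpartials_rcons s i f : cpartials (rcons s i) f = cpartials s (cpartial i f).
Proof. by rewrite /cpartials foldr_rcons. Qed.

Lemma cpartials_cat s t f : cpartials (s ++ t) f = cpartials s (cpartials t f).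
Proof. by rewrite /cpartials foldr_cat. Qed.

Lemma smooth_cpartials U f t : smooth U f -> smooth U (cpartials t f).
Proof. by move=> sf s x Ux; rewrite -cpartials_cat; exact: sf. Qed.

Lemma smooth_cpartial U f i : smooth U f -> smooth U (cpartial i f).
Proof. by move=> sf; exact: (@smooth_cpartials U f [:: i]). Qed.

Lemma smooth_subset U V f : U `<=` V -> smooth V f -> smooth U f.
Proof. by move=> UV sf s x /UV; exact: sf. Qed.

Lemma smooth_is_cpartial U f x i : smooth U f -> U x -> is_cpartial f x i (cpartial i f x).
Proof. by move=> /(_ [::] x) sf /sf[/(_ i)/cderivableP]. Qed.

Lemma smooth_ccontinuous U f x : smooth U f -> U x -> ccontinuous_at f x.
Proof. by move=> /(_ [::] x) sf /sf[]. Qed.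

(** Differentiation is local: all the nets below are compared by first replacing
    them, on a small ball, by a simpler function. *)
Lemma eq_cpartials_open U f g s : open U -> (forall x, U x -> f x = g x) ->
  forall x, U x -> cpartials s f x = cpartials s g x.
Proof.
move=> oU fg; elim: s => [|i s IH] //= x Ux.
apply: near_cpartial; apply: filterS (open_nbhs_nbhs (conj oU Ux)) => y.
exact: IH.
Qed.

Lemma eq_smooth_open U f g : open U -> (forall x, U x -> f x = g x) ->
  smooth U f -> smooth U g.
Proof.
move=> oU fg sf s x Ux; have [sd sc] := sf s x Ux.
have nfg : \near x, cpartials s f x = cpartials s g x.
  apply: filterS (open_nbhs_nbhs (conj oU Ux)) => y.
  exact: eq_cpartials_open.
split; last exact: near_ccontinuous sc.
move=> i; exact: is_cpartial_derivable (near_is_cpartial nfg (cderivableP (sd i))).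
Qed.

(** Smooth functions form the largest such class, so smoothness can be proved without
    an induction on the order of the derivatives. *)
Lemma smooth_coinduction (P : set (E -> C)) :
  (forall f, P f -> forall x, (forall i, cderivable f x i) /\ ccontinuous_at f x) ->
  (forall f i, P f -> P (cpartial i f)) ->
  P `<=` smooth setT.
Proof.
move=> P1 P2 f Pf s x _; apply: P1.
by elim: s => //= i s IH; exact: P2.
Qed.

(** The algebra generated by the smooth functions.  The Leibniz rule makes it stable
    under partial derivatives, which is the shape that the coinduction principle
    asks for, whereas products of two smooth functions alone are not stable. *)
Inductive smooth_algebra : set (E -> C) :=
| SmoothGen f of smooth setT f : smooth_algebra f
| SmoothAdd f g of smooth_algebra f & smooth_algebra g :
    smooth_algebra (fun x => f x + g x)
| SmoothMul f g of smooth_algebra f & smooth_algebra g :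
    smooth_algebra (fun x => f x * g x).

Lemma smooth_algebra_derivable f : smooth_algebra f ->
  forall x, (forall i, cderivable f x i) /\ ccontinuous_at f x.
Proof.
elim=> {f} [f sf x|f g _ IHf _ IHg x|f g _ IHf _ IHg x].
- exact: (sf [::] x).
- have [f1 f2] := IHf x; have [g1 g2] := IHg x; split; last exact: ccontinuousD.
  by move=> i; apply: is_cpartial_derivable
    (is_cpartialD (cderivableP (f1 i)) (cderivableP (g1 i))).
- have [f1 f2] := IHf x; have [g1 g2] := IHg x; split; last exact: ccontinuousM.
  by move=> i; apply: is_cpartial_derivable
    (is_cpartialM (cderivableP (f1 i)) (cderivableP (g1 i))).
Qed.

Lemma cpartialD f g i : (forall x, cderivable f x i) -> (forall x, cderivable g x i) ->
  cpartial i (fun x => f x + g x) = fun x => cpartial i f x + cpartial i g x.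
Proof.
move=> df dg; apply/funext => x; apply: is_cpartialE.
exact: is_cpartialD (cderivableP (df x)) (cderivableP (dg x)).
Qed.

Lemma cpartialM f g i : (forall x, cderivable f x i) -> (forall x, cderivable g x i) ->
  cpartial i (fun x => f x * g x) = fun x => cpartial i f x * g x + f x * cpartial i g x.
Proof.
move=> df dg; apply/funext => x; apply: is_cpartialE.
exact: is_cpartialM (cderivableP (df x)) (cderivableP (dg x)).
Qed.

Lemma smooth_algebra_smooth : smooth_algebra `<=` smooth setT.
Proof.
apply: smooth_coinduction; first exact: smooth_algebra_derivable.
move=> f i; elim=> {f} [f sf|f g Af IHf Ag IHg|f g Af IHf Ag IHg].
- by apply: SmoothGen; exact: smooth_cpartial.
- rewrite cpartialD; first exact: SmoothAdd.
    by move=> x; have [] := smooth_algebra_derivable Af x.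
  by move=> x; have [] := smooth_algebra_derivable Ag x.
- rewrite cpartialM; first by apply: SmoothAdd; exact: SmoothMul.
    by move=> x; have [] := smooth_algebra_derivable Af x.
  by move=> x; have [] := smooth_algebra_derivable Ag x.
Qed.

Lemma smoothM f g : smooth setT f -> smooth setT g -> smooth setT (fun x => f x * g x).
Proof. by move=> sf sg; apply: smooth_algebra_smooth; apply: SmoothMul; exact: SmoothGen. Qed.

Lemma smooth_cst (c : C) : smooth setT (fun _ : E => c).
Proof.
apply: (@smooth_coinduction [set f | exists c, f = fun _ : E => c]); last by exists c.
  move=> _ [c' ->] x; split; last exact: ccontinuous_cst.
  by move=> i; exact: is_cpartial_derivable (is_cpartial_cst c' x i).
move=> _ i [c' ->]; exists 0; apply/funext => x.
exact: is_cpartialE (is_cpartial_cst c' x i).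
Qed.

(** Partial derivatives are only known to exist on U, so linearity is proved on U by
    induction, through equality near each point. *)
Lemma cpartials_linear U (c : C) f g s : open U -> smooth U f -> smooth U g ->
  forall x, U x -> cpartials s (fun x => c * f x + g x) x =
     c * cpartials s f x + cpartials s g x.
Proof.
move=> oU sf sg; elim: s => [|i s IH] //= x Ux.
transitivity (cpartial i (fun x => c * cpartials s f x + cpartials s g x) x).
  by apply: near_cpartial; apply: filterS (open_nbhs_nbhs (conj oU Ux)) => y; exact: IH.
apply: is_cpartialE.
have e1 := smooth_is_cpartial i (smooth_cpartials s sf) Ux.
have e2 := smooth_is_cpartial i (smooth_cpartials s sg) Ux.
have := is_cpartialD (is_cpartialM (is_cpartial_cst c x i) e1) e2.
by rewrite mul0r add0r.
Qed.

Lemma smooth_linear U (c : C) f g : open U -> smooth U f -> smooth U g ->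
  smooth U (fun x => c * f x + g x).
Proof.
move=> oU sf sg s x Ux.
have nE : \near x, (fun x => c * cpartials s f x + cpartials s g x) x =
     cpartials s (fun x => c * f x + g x) x.
  apply: filterS (open_nbhs_nbhs (conj oU Ux)) => y Uy; symmetry.
  exact: (cpartials_linear _ _ oU).
have [f1 f2] := sf s x Ux; have [g1 g2] := sg s x Ux; split; last first.
  apply: (near_ccontinuous nE); apply: ccontinuousD g2.
  exact: ccontinuousM (ccontinuous_cst c x) f2.
move=> i; apply: (is_cpartial_derivable (near_is_cpartial nE _)).
apply: is_cpartialD (cderivableP (g1 i)).
exact: is_cpartialM (is_cpartial_cst c x i) (cderivableP (f1 i)).
Qed.

Lemma cpartialsB U f g s : open U -> smooth U f -> smooth U g ->
  forall x, U x -> cpartials s (fun x => f x - g x) x =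
     cpartials s f x - cpartials s g x.
Proof.
move=> oU sf sg x Ux.
rewrite (_ : (fun x => f x - g x) = (fun x => (-1) * g x + f x)); last first.
  by apply/funext => y; rewrite mulN1r addrC.
by rewrite (cpartials_linear _ _ oU sg sf)// mulN1r addrC.
Qed.

Lemma smoothB U f g : open U -> smooth U f -> smooth U g -> smooth U (fun x => f x - g x).
Proof.
move=> oU sf sg.
rewrite (_ : (fun x => f x - g x) = (fun x => (-1) * g x + f x)); last first.
  by apply/funext => y; rewrite mulN1r addrC.
exact: smooth_linear.
Qed.

Lemma cpartials_affine f (c : R) w s : smooth setT f ->
  cpartials s (fun y => f (c *: y + w)) =
  fun y => (c ^+ size s)%:C * cpartials s f (c *: y + w).
Proof.
move=> sf; elim: s => [|i s IH].
  by apply/funext => y /=; rewrite expr0 mul1r.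
rewrite /= IH; apply/funext => y; apply: is_cpartialE.
have e1 := smooth_is_cpartial i (smooth_cpartials s sf) (I : setT (c *: y + w)).
have := is_cpartialM (is_cpartial_cst (c ^+ size s)%:C y i) (is_cpartial_affine e1).
by rewrite mul0r add0r mulrA -rmorphM /= -exprSr.
Qed.

Lemma smooth_affine f (c : R) w : smooth setT f -> smooth setT (fun y => f (c *: y + w)).
Proof.
move=> sf s y _; rewrite (cpartials_affine c w s sf); split.
  move=> i.
  have e1 := smooth_is_cpartial i (smooth_cpartials s sf) (I : setT (c *: y + w)).
  exact: is_cpartial_derivable
    (is_cpartialM (is_cpartial_cst (c ^+ size s)%:C y i) (is_cpartial_affine e1)).
apply: ccontinuousM; first exact: ccontinuous_cst.
apply: (@ccontinuous_comp (cpartials s f) (fun y => c *: y + w)).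
  exact: (cvgD (@scaler_continuous _ _ c y) (cvg_cst w)).
exact: smooth_ccontinuous (smooth_cpartials s sf) _.
Qed.

Lemma cpartial_swap f i j : smooth setT f ->
  cpartial i (cpartial j f) = cpartial j (cpartial i f).
Proof.
move=> sf; apply/funext => x.
have sj := smooth_cpartial j sf; have si := smooth_cpartial i sf.
have D1 k y : cderivable f y k by have [+ _] := sf [::] y I; apply.
have Di k y : cderivable (cpartial i f) y k by have [+ _] := si [::] y I; apply.
have Dj k y : cderivable (cpartial j f) y k by have [+ _] := sj [::] y I; apply.
have [cij1 cij2] := smooth_ccontinuous (smooth_cpartial i sj) (I : setT x).
have [cji1 cji2] := smooth_ccontinuous (smooth_cpartial j si) (I : setT x).
apply: eq_complexP.
- exact: (@symmetry_second_derivative _ _ (re_part f) (basis_vec j) (basis_vec i) x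
    (fun y => (D1 j y).1) (fun y => (D1 i y).1) (fun y => (Dj i y).1)
    (fun y => (Di j y).1) cij1 cji1).
- exact: (@symmetry_second_derivative _ _ (im_part f) (basis_vec j) (basis_vec i) x
    (fun y => (D1 j y).2) (fun y => (D1 i y).2) (fun y => (Dj i y).2)
    (fun y => (Di j y).2) cij2 cji2).
Qed.

Lemma cpartial_cpartials f i s : smooth setT f ->
  cpartials s (cpartial i f) = cpartial i (cpartials s f).
Proof.
move=> sf; elim: s => //= j s ->.
by rewrite cpartial_swap//; exact: smooth_cpartials.
Qed.

(** Decay of a Schwartz function and continuity of a distribution are expressed with
    partials taken in increasing order of the variables, while differentiating a
    convolution prepends arbitrary ones; this reorders them. *)
Lemma cpartials_perm f s t : smooth setT f -> perm_eq s t -> cpartials s f = cpartials t f.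
Proof.
move=> sf; elim: s t => [|i s IH] t.
  by rewrite perm_sym => /perm_nilP ->.
move=> pst; have it : i \in t by rewrite -(perm_mem pst) mem_head.
have /splitPr it' := it; case: it' pst it => t1 t2 pst _.
have /IH e : perm_eq s (t1 ++ t2).
  by rewrite -(perm_cons i) (perm_trans pst)// -cat1s perm_catCA.
rewrite /= e cpartials_cat cpartials_cat /= -cpartial_cpartials//.
exact: smooth_cpartials.
Qed.

End ComplexPartials.

(** * Bounds on derivatives and seminorms *)

Section Bounds.
Context {R : realType} {d : nat}.
Local Notation E := 'rV[R]_d.
Local Notation C := R[i].
Implicit Types (f g h : E -> C) (U K : set E) (x y w z : E).
Implicit Types (i j : 'I_d) (s t : seq 'I_d).
Local Notation normc := Normc.normc.
Local Notation Re := complex.Re.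
Local Notation Im := complex.Im.

Lemma normc_ge0 (a : C) : 0 <= normc a.
Proof. by case: a => ? ?; exact: sqrtr_ge0. Qed.

Lemma normcD_le (a b : C) : normc (a + b) <= normc a + normc b.
Proof. exact: (@le_normcD R a b). Qed.

Lemma normc_opp (a : C) : normc (- a) = normc a.
Proof. exact: (@normcN R a). Qed.

Lemma normcB_le (a b : C) : normc (a - b) <= normc a + normc b.
Proof. by rewrite -(normc_opp b); exact: normcD_le. Qed.

Lemma normc_real (r : R) : normc r%:C = `|r|.
Proof. by rewrite /= expr0n /= addr0 sqrtr_sqr. Qed.

Lemma normr_Re_le (a : C) : `|Re a| <= normc a.
Proof.
by case: a => p q /=; rewrite -sqrtr_sqr ler_wsqrtr// lerDl sqr_ge0.
Qed.

Lemma normr_Im_le (a : C) : `|Im a| <= normc a.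
Proof.
by case: a => p q /=; rewrite -sqrtr_sqr ler_wsqrtr// lerDr sqr_ge0.
Qed.

Lemma normc_le_ReIm (a : C) : normc a <= `|Re a| + `|Im a|.
Proof.
have e : a = (Re a)%:C + 'i%C * (Im a)%:C.
  by case: a => p q; apply: eq_complexP => /=; ring.
rewrite [in leLHS]e (le_trans (normcD_le _ _))// Normc.normcM !normc_real.
by rewrite /= expr0n /= add0r expr1n sqrtr1 mul1r.
Qed.

Lemma compact_bound K f : compact K -> (forall x, K x -> ccontinuous_at f x) ->
  exists M : R, forall x, K x -> normc (f x) <= M.
Proof.
move=> cK cf.
have bnd (u : E -> R) : (forall x, K x -> {for x, continuous u}) ->
    exists M : R, forall x, K x -> `|u x| <= M.
  move=> cu.
  have cw : {within K, continuous u}.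
    by apply: continuous_in_subspaceT => x; rewrite inE => /cu.
  have [M [_ HM]] := compact_bounded (continuous_compact cw cK).
  exists (M + 1) => x Kx; apply: (HM (M + 1)); first by rewrite ltrDl.
  by exists x.
have [M1 H1] := bnd (re_part f) (fun x Kx => (cf x Kx).1).
have [M2 H2] := bnd (im_part f) (fun x Kx => (cf x Kx).2).
exists (M1 + M2) => x Kx; apply: (le_trans (normc_le_ReIm _)).
by apply: lerD; [exact: H1|exact: H2].
Qed.

(** There are finitely many words of length at most n in the d variables, so bounds
    for each of them give a common one. *)
Lemma uniform_order_bound (P : seq 'I_d -> R -> Prop) (n : nat) :
  (forall s M M', M <= M' -> P s M -> P s M') -> (forall s, exists M, P s M) ->
  exists2 M, 0 <= M & forall s, (size s <= n)%N -> P s M.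
Proof.
move=> mono /choice[M PM].
exists (\sum_(b : n.-bseq 'I_d) `|M b|); first exact: sumr_ge0.
move=> s sn; apply: mono (PM s).
rewrite (bigD1 (Bseq sn))//= (le_trans (ler_norm _))// lerDl.
exact: sumr_ge0.
Qed.

Lemma compact_partials_bound U K f n : compact K -> K `<=` U -> smooth U f ->
  exists2 M : R, 0 <= M & forall s x, (size s <= n)%N -> K x ->
    normc (cpartials s f x) <= M.
Proof.
move=> cK KU sf.
have [] := @uniform_order_bound (fun s M => forall x, K x -> normc (cpartials s f x) <= M) n.
- by move=> s M M' MM' H x Kx; exact: le_trans (H x Kx) MM'.
- move=> s; apply: compact_bound cK _ => x Kx.
  exact: smooth_ccontinuous (smooth_cpartials s sf) (KU x Kx).
- by move=> M M0 H; exists M => // s x sn Kx; exact: H.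
Qed.

Lemma mpartialE (a : multi_index d) f :
  exists2 s, size s = mdeg a & mpartial a f = cpartials s f.
Proof.
exists (flatten [seq nseq (a i) i | i <- enum 'I_d]) => //.
rewrite size_flatten /shape -map_comp sumnE big_map big_enum /=.
by apply: eq_bigr => i _; rewrite size_nseq.
Qed.

Lemma cpartials_mpartial f s : smooth setT f ->
  exists a : multi_index d, cpartials s f = mpartial a f.
Proof.
move=> sf; exists [ffun i => count_mem i s]; apply: cpartials_perm => //.
apply/allP => i _; apply/eqP.
rewrite count_flatten -map_comp sumnE big_map big_enum /= (bigD1 i)//=.
rewrite count_nseq ffunE /= eqxx mul1n big1 ?addn0// => j ji.
by rewrite count_nseq /= (negbTE ji).
Qed.

(** The supremum over an empty set is 0, hence the hypothesis on B. *)
Lemma seminorm_le K l f (B : R) : 0 <= B ->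
  (forall a x, (mdeg a <= l)%N -> K x -> normc (mpartial a f x) <= B) ->
  seminorm K l f <= B.
Proof.
move=> B0 H; rewrite /seminorm; set S := (X in sup X).
have [->|/set0P S0] := eqVneq S set0; first by rewrite sup0.
by apply: ge_sup => // _ [a [x [al Kx ->]]]; exact: H.
Qed.

(** The derivatives are continuous on the compact K, so the supremum is that of a
    bounded set and does bound its elements. *)
Lemma le_seminorm U K l f a x : compact K -> K `<=` U -> smooth U f ->
  (mdeg a <= l)%N -> K x -> normc (mpartial a f x) <= seminorm K l f.
Proof.
move=> cK KU sf al Kx; apply: ub_le_sup; last by exists a, x.
have [M M0 H] := compact_partials_bound l cK KU sf.
exists M => _ [b [y [bl Ky ->]]]; have [s ss ->] := mpartialE b f.
by apply: H => //; rewrite ss.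
Qed.

Lemma seminorm_ge0 U K l f : compact K -> K `<=` U -> smooth U f -> 0 <= seminorm K l f.
Proof.
move=> cK KU sf.
have [->|/set0P[x Kx]] := eqVneq K set0.
  rewrite /seminorm (_ : [set r | _] = set0) ?sup0//.
  by apply/seteqP; split=> // r [a [x []]].
apply: le_trans (@le_seminorm U K l f [ffun=> 0%N] x cK KU sf _ Kx).
  exact: normc_ge0.
by rewrite /mdeg big1// => i _; rewrite ffunE.
Qed.

(** Each derivation doubles the number of terms of the Leibniz formula.  The last
    derivative is peeled off, so that the induction hypothesis applies to the
    products (d_i f) g and f (d_i g). *)
Lemma leibniz_bound f g s y (A B : R) : smooth setT f -> smooth setT g ->
  0 <= A -> 0 <= B ->
  (forall t, (size t <= size s)%N -> normc (cpartials t f y) <= A) ->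
  (forall t, (size t <= size s)%N -> normc (cpartials t g y) <= B) ->
  normc (cpartials s (fun x => f x * g x) y) <= 2 ^+ size s * (A * B).
Proof.
move=> + + A0 B0.
elim/last_ind: s f g => [|s i IH] f g sf sg fA gB.
  by rewrite /= expr0 mul1r Normc.normcM ler_pM ?normc_ge0// (fA [::], gB [::]).
rewrite cpartials_rcons cpartialM; last 2 first.
- by move=> x; have [+ _] := sf [::] x I; apply.
- by move=> x; have [+ _] := sg [::] x I; apply.
have sfi := smooth_cpartial i sf; have sgi := smooth_cpartial i sg.
rewrite (_ : (fun x => _ + _) = fun x => 1 * (cpartial i f x * g x) + f x * cpartial i g x);
  last by apply/funext => x; rewrite mul1r.
rewrite (cpartials_linear _ _ openT (smoothM sfi sg) (smoothM sf sgi))// mul1r.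
rewrite size_rcons exprS -mulrA mulr2n mulrDl mul1r.
apply: (le_trans (normcD_le _ _)); apply: lerD; apply: IH => // t ts.
- by rewrite -cpartials_rcons; apply: fA; rewrite !size_rcons.
- by apply: gB; rewrite size_rcons (leq_trans ts).
- by apply: fA; rewrite size_rcons (leq_trans ts).
- by rewrite -cpartials_rcons; apply: gB; rewrite !size_rcons.
Qed.

End Bounds.

(** * Regularization of a cut-off distribution *)

Section Convolution.
Context {R : realType} {d : nat}.
Local Notation E := 'rV[R]_d.
Local Notation C := R[i].
Implicit Types (f g h k : E -> C) (U K Omega : set E) (x y w z : E).
Implicit Types (i j : 'I_d) (s t : seq 'I_d).
Local Notation normc := Normc.normc.
Local Notation Re := complex.Re.
Local Notation Im := complex.Im.

Lemma pairing_linear Omega (T : schwartz_distribution Omega) (c : C) f g :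
  testfun Omega f -> testfun Omega g ->
  T (fun x => c * f x + g x) = c * T f + T g.
Proof. by case: T => p /= lin _ _; exact: lin. Qed.

Lemma pairing_continuous Omega (T : schwartz_distribution Omega) K :
  compact K -> K `<=` Omega -> exists (M : R) (l : nat), forall f,
    testfun Omega f -> supp f `<=` K -> normc (T f) <= M * seminorm K l f.
Proof. by case: T => p /= _ cont _; exact: cont. Qed.

Lemma closed_supp f : closed (supp f).
Proof. exact: closed_closure. Qed.

Lemma supp_sub f x : f x != 0 -> supp f x.
Proof. by move=> fx; apply: subset_closure. Qed.

Lemma smooth_reflect g x : smooth setT g -> smooth setT (fun y => g (x - y)).
Proof.
move=> sg; rewrite (_ : (fun y => _) = fun y => g ((-1) *: y + x)).
  exact: smooth_affine.
by apply/funext => y; rewrite scaleN1r addrC.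
Qed.

Lemma normc_cpartials_reflect g x s y : smooth setT g ->
  normc (cpartials s (fun y => g (x - y)) y) = normc (cpartials s g (x - y)).
Proof.
move=> sg; rewrite (_ : (fun y => g (x - y)) = fun y => g ((-1) *: y + x)); last first.
  by apply/funext => z; rewrite scaleN1r addrC.
rewrite (cpartials_affine _ _ s sg) Normc.normcM normc_real normrX normrN1 expr1n mul1r.
by rewrite scaleN1r [- y + x]addrC.
Qed.

Lemma supp_mull k g : supp (fun y => k y * g y) `<=` supp k.
Proof.
apply: closure_subset => y /=; apply: contra_neq => ->; exact: mul0r.
Qed.

(** The support of k g is a closed part of the support of k. *)
Lemma testfunM Omega k g : testfun Omega k -> smooth setT g ->
  testfun Omega (fun y => k y * g y).
Proof.
move=> [sk ck kO] sg; split; first exact: smoothM.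
  exact: subclosed_compact (@closed_supp _) ck (@supp_mull k g).
exact: subset_trans (@supp_mull k g) kO.
Qed.

(** The estimate behind everything that follows: a distribution has finite order on
    the support of k, so its value on k g(x - .) is controlled by finitely many
    derivatives of g on the set x - supp k, by the Leibniz rule.  Differentiability,
    continuity, moderateness and negligibility of convolutions all come from
    choosing g. *)
Lemma distribution_bound Omega (T : schwartz_distribution Omega) k : testfun Omega k ->
  exists (M : R) (N : nat), 0 <= M /\ forall g x (A : R), smooth setT g -> 0 <= A ->
    (forall s y, (size s <= N)%N -> supp k y -> normc (cpartials s g (x - y)) <= A) ->
    normc (convolution (cutoff k T) g x) <= M * A.
Proof.
move=> tk; have [sk ck kO] := tk.
have [M0 [N HT]] := pairing_continuous T ck kO.
have [B B0 HB] := compact_partials_bound N ck (@subsetT _ _) sk.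
exists (`|M0| * (2 ^+ N * B)), N; split.
  by rewrite !mulr_ge0// exprn_ge0.
move=> g x A sg A0 HA; rewrite /convolution /cutoff.
have sr := smooth_reflect x sg.
have tkg := testfunM tk sr.
apply: (le_trans (HT _ tkg (@supp_mull _ _))).
apply: (@le_trans _ _ (`|M0| * seminorm (supp k) N (fun y => k y * g (x - y)))).
  apply: ler_wpM2r; last exact: ler_norm.
  by apply: (seminorm_ge0 N ck (@subsetT _ _)); case: tkg.
rewrite -mulrA; apply: ler_wpM2l => //; apply: seminorm_le.
  by rewrite !mulr_ge0// exprn_ge0.
move=> a y al ky; have [s ss ->] := mpartialE a (fun y => k y * g (x - y)).
rewrite -ss in al.
have := @leibniz_bound _ _ k (fun y => g (x - y)) s y B A sk sr B0 A0 _ _.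
move=> /(_ (fun t ts => HB t y (leq_trans ts al) ky)) H.
apply: (le_trans (H _)).
  move=> t ts; rewrite normc_cpartials_reflect//; apply: HA => //.
  exact: leq_trans ts al.
rewrite -mulrA; apply: ler_wpM2r; first exact: mulr_ge0.
by rewrite ler_eXn2l// ltr1n.
Qed.

Lemma convolution_linear Omega (T : schwartz_distribution Omega) k (c : C) f g x :
  testfun Omega k -> smooth setT f -> smooth setT g ->
  convolution (cutoff k T) (fun z => c * f z + g z) x =
  c * convolution (cutoff k T) f x + convolution (cutoff k T) g x.
Proof.
move=> tk sf sg; rewrite /convolution /cutoff.
have := pairing_linear T c (testfunM tk (smooth_reflect x sf)) (testfunM tk (smooth_reflect x sg)).
move=> <-; congr (T _); apply/funext => y; ring.
Qed.

Lemma closed_ball0_compact (r : R) : compact [set z : E | `|z| <= r].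
Proof.
apply: bounded_closed_compact.
  by exists r; split; [exact: num_real|move=> M rM z /= zr; apply: le_trans zr (ltW rM)].
apply: (@closed_comp _ _ (fun z : E => `|z|) [set x | x <= r]) => //.
  by move=> z _; exact: norm_continuous.
Qed.

Lemma supp_bounded Omega k : testfun Omega k -> exists2 r : R, 0 <= r &
  forall y, supp k y -> `|y| <= r.
Proof.
move=> [_ ck _]; have [M [_ HM]] := compact_bounded ck.
exists (`|M| + 1); first by rewrite addr_ge0.
by move=> y ky; apply: HM => //; rewrite (le_lt_trans (ler_norm _))// ltrDl.
Qed.

Lemma is_cpartial_quotient_bound f x i (D : C) (M : R) :
  (forall h : R, h != 0 -> `|h| <= 1 ->
     normc ((h^-1)%:C * (f (h *: basis_vec i + x) - f x) - D) <= M * `|h|) ->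
  is_cpartial f x i D.
Proof.
move=> H; split; apply: (is_derive_quotient_bound (M := M)) => h h0 h1.
  apply: le_trans (H h h0 h1); apply: le_trans (normr_Re_le _).
  rewrite /re_part; case: (f _) (f x) D {H} => p q [p' q'] [a b] /=.
  by rewrite mul0r subr0.
apply: le_trans (H h h0 h1); apply: le_trans (normr_Im_le _).
rewrite /im_part; case: (f _) (f x) D {H} => p q [p' q'] [a b] /=.
by rewrite mul0r addr0.
Qed.

Lemma cquotient_second_order f z i (h M : R) : smooth setT f ->
  h != 0 -> `|h| <= 1 ->
  (forall t : R, `|t| <= 1 ->
     normc (cpartial i (cpartial i f) (t *: basis_vec i + z)) <= M) ->
  normc ((h^-1)%:C * (f (h *: basis_vec i + z) - f z) - cpartial i f z) <= (M + M) * `|h|.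
Proof.
move=> sf h0 h1 HM.
have si := smooth_cpartial i sf.
have D1 y : cderivable f y i by have [+ _] := sf [::] y I; apply.
have Di y : cderivable (cpartial i f) y i by have [+ _] := si [::] y I; apply.
apply: (le_trans (normc_le_ReIm _)); rewrite mulrDl; apply: lerD.
  have := @quotient_second_order R E (re_part f) z (basis_vec i) h M
    (fun y => (D1 y).1) (fun y => (Di y).1) h0 h1.
  have HM1 (t : R) : `|t| <= 1 ->
      `|'D_(basis_vec i) ('D_(basis_vec i) (re_part f)) (t *: basis_vec i + z)| <= M.
    move=> t1; apply: le_trans (HM t t1).
    exact: (normr_Re_le (cpartial i (cpartial i f) (t *: basis_vec i + z))).
  move=> /(_ HM1); apply: le_trans; rewrite le_eqVlt; apply/orP; left; apply/eqP.
  congr (`| _ |); rewrite /cpartial /re_part /=.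
  by case: (f _) (f z) => p q [p' q'] /=; rewrite mul0r subr0.
have := @quotient_second_order R E (im_part f) z (basis_vec i) h M
  (fun y => (D1 y).2) (fun y => (Di y).2) h0 h1.
have HM1 (t : R) : `|t| <= 1 ->
    `|'D_(basis_vec i) ('D_(basis_vec i) (im_part f)) (t *: basis_vec i + z)| <= M.
  move=> t1; apply: le_trans (HM t t1).
  exact: (normr_Im_le (cpartial i (cpartial i f) (t *: basis_vec i + z))).
move=> /(_ HM1); apply: le_trans; rewrite le_eqVlt; apply/orP; left; apply/eqP.
congr (`| _ |); rewrite /cpartial /im_part /=.
by case: (f _) (f z) => p q [p' q'] /=; rewrite mul0r addr0.
Qed.

(** Apply the bound to the function q_h that is the difference quotient of g minus
    its derivative: its derivatives of any order are O(h) uniformly on bounded sets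
    because g has bounded second derivatives there. *)
Lemma is_cpartial_convolution Omega (T : schwartz_distribution Omega) k g x i :
  testfun Omega k -> smooth setT g ->
  is_cpartial (convolution (cutoff k T) g) x i (convolution (cutoff k T) (cpartial i g) x).
Proof.
move=> tk sg.
have [M [N [M0 HM]]] := distribution_bound T tk.
have [r r0 Hr] := supp_bounded tk.
have si := smooth_cpartial i sg.
(* All points x - y + t e_i with y in supp k and |t| <= 1 have norm at most rr. *)
pose rr : R := `|basis_vec i : E| + (`|x| + r).
have [B B0 HB] := compact_partials_bound N (@closed_ball0_compact rr) (@subsetT _ _)
  (smooth_cpartial i si).
apply: (@is_cpartial_quotient_bound _ _ _ _ (M * (B + B))) => h h0 h1.
pose v : E := basis_vec i.
have st : smooth setT (fun z => g (1 *: z + h *: v)) by exact: smooth_affine.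
pose q z := (h^-1)%:C * (g (1 *: z + h *: v) - g z) - cpartial i g z.
have sq : smooth setT q.
  apply: smoothB openT _ si; apply: smoothM; first exact: smooth_cst.
  exact: smoothB openT st sg.
have qE s z : cpartials s q z = (h^-1)%:C * (cpartials s g (h *: v + z) - cpartials s g z)
    - cpartial i (cpartials s g) z.
  rewrite (cpartialsB s openT _ si)//; last first.
    by apply: smoothM; [exact: smooth_cst|exact: smoothB openT st sg].
  rewrite (_ : (fun x0 => _ * _) = fun z => (h^-1)%:C * (g (1 *: z + h *: v) - g z) + 0);
    last by apply/funext => y; rewrite addr0.
  rewrite (cpartials_linear _ s openT (smoothB openT st sg) (@smooth_cst _ _ 0))//.
  rewrite cpartials_0 addr0 (cpartialsB s openT st sg)//.
  rewrite (cpartials_affine 1 (h *: v) s sg) expr1n mul1r scale1r.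
  by rewrite [z + _]addrC cpartial_cpartials.
have -> : (h^-1)%:C * (convolution (cutoff k T) g (h *: v + x) - convolution (cutoff k T) g x)
   - convolution (cutoff k T) (cpartial i g) x = convolution (cutoff k T) q x.
  have -> : convolution (cutoff k T) g (h *: v + x) =
     convolution (cutoff k T) (fun z => g (1 *: z + h *: v)) x.
    rewrite /convolution /cutoff; congr (T _); apply/funext => y.
    by rewrite scale1r -addrA [h *: v + _]addrC.
  rewrite /q.
  have -> : (fun z => (h^-1)%:C * (g (1 *: z + h *: v) - g z) - cpartial i g z) =
     fun z => (-1) * cpartial i g z + ((h^-1)%:C * ((-1) * g z + g (1 *: z + h *: v)) + 0).
    by apply/funext => z; ring.
  have s1 : smooth setT (fun z => (-1) * g z + g (1 *: z + h *: v)).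
    exact: smooth_linear openT sg st.
  have s2 := smooth_linear (h^-1)%:C openT s1 (@smooth_cst _ _ 0).
  rewrite (convolution_linear T (-1) x tk si s2).
  rewrite (convolution_linear T _ x tk s1 (@smooth_cst _ _ 0)).
  rewrite (convolution_linear T (-1) x tk sg st).
  have -> : convolution (cutoff k T) (fun=> 0) x = 0.
    have := convolution_linear T (-1) x tk (@smooth_cst _ _ 0) (@smooth_cst _ _ 0).
    have -> : (fun _ : E => -1 * 0 + 0) = (fun=> 0 : C) by apply/funext => ?; ring.
    by move=> ->; ring.
  ring.
rewrite -mulrA; apply: HM => //.
  by rewrite mulr_ge0// addr_ge0.
move=> s y sN ky; rewrite qE.
apply: (cquotient_second_order (smooth_cpartials s sg) h0 h1) => t t1.
rewrite -!cpartial_cpartials//.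
apply: HB => //=; rewrite /rr.
apply: (le_trans (ler_normD _ _)); apply: lerD.
  by rewrite normrZ ler_piMl.
by apply: (le_trans (ler_normB _ _)); apply: lerD => //; exact: Hr.
Qed.

Lemma ccontinuousP f x : ccontinuous_at f x <->
  forall e : R, 0 < e -> \forall y \near x, normc (f y - f x) <= e.
Proof.
split=> [[cr ci] e e0|H].
  have e20 : 0 < e / 2 by rewrite divr_gt0.
  have /cvgrPdist_le/(_ _ e20) h1 := cr; have /cvgrPdist_le/(_ _ e20) h2 := ci.
  apply: filterS2 h1 h2 => y h1 h2; rewrite [e]splitr.
  apply: (le_trans (normc_le_ReIm _)); apply: lerD.
    by move: h1; rewrite /re_part distrC; case: (f y) (f x) => ? ? [].
  by move: h2; rewrite /im_part distrC; case: (f y) (f x) => ? ? [].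
split; apply/(@cvgrPdist_le _ _ _ (nbhs x) (nbhs_filter x)) => e /H;
  apply: filterS => y; apply: le_trans;
rewrite distrC.
  apply: le_trans (normr_Re_le _).
  by rewrite /re_part; case: (f y) (f x) => ? ? [].
apply: le_trans (normr_Im_le _).
by rewrite /im_part; case: (f y) (f x) => ? ? [].
Qed.

(** Continuity of f on a compact set is uniform. *)
Lemma uniform_translation K f x (e : R) : compact K -> (forall z, ccontinuous_at f z) ->
  0 < e -> \forall x' \near x, K `<=` [set y | normc (f (x' - y) - f (x - y)) <= e].
Proof.
move=> cK cf e0.
apply: ((compact_near_coveringP K).1 cK E (nbhs x)
    (fun x' y => normc (f (x' - y) - f (x - y)) <= e)) => y Ky.
have e20 : 0 < e / 2 by rewrite divr_gt0.
have /ccontinuousP/(_ _ e20)/nbhs_ballP[r /= r0 Hr] := cf (x - y).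
have r20 : 0 < r / 2 by rewrite divr_gt0.
exists (ball y (r / 2), ball x (r / 2)); first by split; exact: nbhsx_ballx.
have near1 (x1 y1 : E) : ball x (r / 2) x1 -> ball y (r / 2) y1 -> ball (x - y) r (x1 - y1).
  rewrite -!ball_normE /= => hx hy.
  have -> : x - y - (x1 - y1) = (x - x1) - (y - y1).
    by rewrite !opprB [y1 - x1]addrC addrACA [- y + y1]addrC.
  rewrite [r]splitr.
  by apply: (le_lt_trans (ler_normB _ _)); exact: ltrD.
move=> [y1 x1] /= [hy hx].
rewrite (_ : f _ - f _ = (f (x1 - y1) - f (x - y)) - (f (x - y1) - f (x - y))); last by ring.
rewrite [e]splitr; apply: (le_trans (normcB_le _ _)); apply: lerD; apply: Hr.
  exact: near1.
by apply: near1 => //; exact: ballxx.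
Qed.

(** Apply the bound to the difference of g and a small translate of g. *)
Lemma ccontinuous_convolution Omega (T : schwartz_distribution Omega) k g x :
  testfun Omega k -> smooth setT g -> ccontinuous_at (convolution (cutoff k T) g) x.
Proof.
move=> tk sg; have [sk ck kO] := tk.
have [M [N [M0 HM]]] := distribution_bound T tk.
have M10 : 0 < M + 1 by rewrite ltr_wpDl.
have unif (e : R) : 0 < e -> \forall x' \near x, forall b : N.-bseq 'I_d,
    supp k `<=` [set y | normc (cpartials b g (x' - y) - cpartials b g (x - y)) <= e].
  move=> e0; apply: (@filter_forall _ _ _ (nbhs x) (nbhs_filter x)) => b.
  apply: uniform_translation => // z.
  exact: smooth_ccontinuous (smooth_cpartials b sg) _.
apply/ccontinuousP => e e0.
have /unif : 0 < e / (M + 1) by rewrite divr_gt0.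
apply: filterS => x' Hx'.
pose q z := (-1) * g z + g (1 *: z + (x' - x)).
have st : smooth setT (fun z => g (1 *: z + (x' - x))) by exact: smooth_affine.
have sq : smooth setT q by exact: smooth_linear openT sg st.
have -> : convolution (cutoff k T) g x' - convolution (cutoff k T) g x =
    convolution (cutoff k T) q x.
  rewrite (convolution_linear T (-1) x tk sg st) mulN1r addrC; congr (_ + _).
  rewrite /convolution /cutoff; congr (T _); apply/funext => y.
  by rewrite scale1r -addrA [- y + _]addrC addrA [x + _]addrC subrK.
apply: (@le_trans _ _ (M * (e / (M + 1)))); last first.
  rewrite mulrCA ger_pMr// ler_pdivrMr// mul1r lerDl//.
apply: HM => //; first by rewrite divr_ge0// ltW.
move=> s y sN ky.
rewrite (cpartials_linear _ s openT sg st)// mulN1r addrC.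
rewrite (cpartials_affine 1 _ s sg) expr1n mul1r scale1r.
have -> : x - y + (x' - x) = x' - y.
  by rewrite -addrA [- y + _]addrC addrA [x + _]addrC subrK.
exact: (Hx' (Bseq sN)).
Qed.

Lemma cpartials_convolution Omega (T : schwartz_distribution Omega) k g s :
  testfun Omega k -> smooth setT g ->
  cpartials s (convolution (cutoff k T) g) = convolution (cutoff k T) (cpartials s g).
Proof.
move=> tk sg; elim: s => //= i s ->; apply/funext => x.
apply: is_cpartialE; apply: is_cpartial_convolution => //.
exact: smooth_cpartials.
Qed.

Lemma smooth_convolution Omega (T : schwartz_distribution Omega) k g :
  testfun Omega k -> smooth setT g -> smooth setT (convolution (cutoff k T) g).
Proof.
move=> tk sg s x _; rewrite cpartials_convolution//; split.
  move=> i; apply: is_cpartial_derivable (is_cpartial_convolution _ _ _ tk _).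
  exact: smooth_cpartials.
by apply: ccontinuous_convolution => //; exact: smooth_cpartials.
Qed.

End Convolution.

(** * Decay of the mollifier *)

Section Mollifiers.
Context {R : realType} {d : nat}.
Local Notation E := 'rV[R]_d.
Local Notation C := R[i].
Implicit Types (f g h k rho chi : E -> C) (U K Omega : set E) (x y w z : E).
Implicit Types (i j : 'I_d) (s t : seq 'I_d).
Local Notation normc := Normc.normc.

(** The sup norm is attained at some coordinate; the summand 1 covers the norm 0. *)
Lemma normr_pow_le x (q : nat) : `|x| ^+ q <= 1 + \sum_(j < d) `|x 0 j| ^+ q.
Proof.
have [x0|x0] := eqVneq `|x| 0.
  by rewrite x0 expr0n; case: (q == 0%N);
    rewrite ?lerDl ?addr_ge0 ?sumr_ge0// => *; exact: exprn_ge0.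
have [[i0 j] /= ij] := mx_norm_neq0 x0.
have -> : `|x| = `|x 0 j| by rewrite [LHS]ij (ord1 i0).
rewrite (bigD1 j)//= addrCA lerDl addr_ge0// sumr_ge0// => k _; exact: exprn_ge0.
Qed.

(** Powers of the sup norm are dominated by the monomials 1 and x_j ^ q. *)
Lemma schwartz_decay rho (q n : nat) : schwartz rho ->
  exists2 M : R, 0 <= M & forall s x, (size s <= n)%N ->
    `|x| ^+ q * normc (cpartials s rho x) <= M.
Proof.
move=> [srho Hrho].
have [] := @uniform_order_bound R d
  (fun s M => forall x, `|x| ^+ q * normc (cpartials s rho x) <= M) n.
- by move=> s M M' MM' H x; exact: le_trans (H x) MM'.
- move=> s; have [b ->] := cpartials_mpartial s srho.
  have [M HM] := choice (fun a => Hrho a b).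
  pose a0 : multi_index d := [ffun=> 0%N].
  pose a1 (j : 'I_d) : multi_index d := [ffun i => if i == j then q else 0%N].
  have m0 x : monomial a0 x = 1.
    by rewrite /monomial big1// => i _; rewrite ffunE expr0.
  have m1 j x : monomial (a1 j) x = x 0 j ^+ q.
    rewrite /monomial (bigD1 j)//= ffunE eqxx big1 ?mulr1// => i ij.
    by rewrite ffunE (negbTE ij) expr0.
  exists (M a0 + \sum_(j < d) M (a1 j)) => x.
  have := normr_pow_le x q; have n0 := normc_ge0 (mpartial b rho x).
  move=> /(ler_wpM2r n0) /le_trans; apply.
  rewrite mulrDl mulr_suml; apply: lerD.
    by have := HM a0 x; rewrite m0 normr1.
  by apply: ler_sum => j _; have := HM (a1 j) x; rewrite m1 normrX.
- by move=> M M0 H; exists M => // s x sn; exact: H.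
Qed.

Lemma cpartials_supp0 f s x : ~ supp f x -> cpartials s f x = 0.
Proof.
move=> nfx.
have oU : open (~` supp f) by apply: closed_openC; exact: closed_supp.
have fU y : (~` supp f) y -> f y = (fun=> 0) y.
  by move=> nfy; apply/eqP/negPn/negP => fy; apply: nfy; exact: supp_sub.
by rewrite (eq_cpartials_open s oU fU nfx) cpartials_0.
Qed.

Lemma testfun_partials_bound Omega k n : testfun Omega k ->
  exists2 M : R, 0 <= M & forall s x, (size s <= n)%N -> normc (cpartials s k x) <= M.
Proof.
move=> [sk ck _].
have [M M0 HM] := compact_partials_bound n ck (@subsetT _ _) sk.
exists M => // s x sn; have [kx|kx] := pselect (supp k x); first exact: HM.
by rewrite cpartials_supp0// Normc.normc0.
Qed.

Lemma normc_cpartials_1 s x : normc (cpartials s (fun _ : E => 1 : C) x) <= 1.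
Proof.
elim/last_ind: s => [|s i _]; first by rewrite le_eqVlt (Normc.normc1 R) eqxx.
rewrite cpartials_rcons.
have -> : cpartial i (fun _ : E => 1 : C) = fun=> 0.
  by apply/funext => y; exact: is_cpartialE (is_cpartial_cst _ _ _).
by rewrite cpartials_0 Normc.normc0.
Qed.

Lemma enorm_ge x : `|x| <= enorm x.
Proof.
have [x0|x0] := eqVneq `|x| 0; first by rewrite x0; exact: sqrtr_ge0.
have [[i0 j] /= ij] := mx_norm_neq0 x0.
have -> : `|x| = `|x 0 j| by rewrite [LHS]ij (ord1 i0).
rewrite -sqrtr_sqr ler_wsqrtr// (bigD1 j)//= lerDl sumr_ge0// => k _; exact: sqr_ge0.
Qed.

Lemma coord_le x j : `|x 0 j| <= `|x|.
Proof.
have := @le_bigmax _ R ('I_1 * 'I_d)%type 0 (fun ij => `|x ij.1 ij.2|) (0, j).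
by rewrite [X in _ -> _ <= X]mx_normrE.
Qed.

Lemma enorm_le x : enorm x <= Num.sqrt d%:R * `|x|.
Proof.
rewrite -[`|x|]ger0_norm// -sqrtr_sqr -sqrtrM// ler_wsqrtr//.
have -> : d%:R = \sum_(j < d) (1 : R) by rewrite sumr_const card_ord.
rewrite mulr_suml; apply: ler_sum => j _.
rewrite mul1r -(real_normK (num_real (x 0 j))).
by apply: lerXn2r; rewrite ?nnegrE//; exact: coord_le.
Qed.

Section AbsLn.
Context (e : R) (e0 : 0 < e) (e1 : e <= expR (-1)).

Lemma abs_ln_ge1 : 1 <= `|ln e|.
Proof.
have : ln e <= -1 by rewrite -[leRHS]expRK ler_ln ?posrE ?expR_gt0.
by move=> h; rewrite ler0_norm; lra.
Qed.

Lemma abs_lnE : `|ln e| = - ln e.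
Proof.
have : ln e <= -1 by rewrite -[leRHS]expRK ler_ln ?posrE ?expR_gt0.
by move=> h; rewrite ler0_norm; lra.
Qed.

Lemma abs_ln_le_inv : `|ln e| <= e^-1.
Proof. by rewrite abs_lnE -lnV ?posrE//; apply/ltW/ln_sublinear; rewrite invr_gt0. Qed.

(** Apply ln y < y to y = 1 / sqrt e, using ln e = 2 ln (sqrt e). *)
Lemma abs_lnM_sqr : (`|ln e| * e) ^+ 2 <= 4 * e.
Proof.
pose r := Num.sqrt e; have r0 : 0 < r by rewrite sqrtr_gt0.
have er : e = r * r by rewrite -expr2 sqr_sqrtr// ltW.
have h : `|ln e| * r <= 2.
  rewrite abs_lnE er lnM ?posrE// -ler_pdivlMr//.
  have : ln r^-1 < r^-1 by apply: ln_sublinear; rewrite invr_gt0.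
  by rewrite lnV ?posrE//; lra.
have -> : `|ln e| * e = (`|ln e| * r) * r by rewrite -mulrA -er.
rewrite exprMn; have -> : r ^+ 2 = e by rewrite expr2 -er.
apply: ler_wpM2r; first exact: ltW.
have -> : 4 = 2 ^+ 2 :> R by rewrite -natrX.
by rewrite ler_sqr ?nnegrE// mulr_ge0// ltW.
Qed.

End AbsLn.

End Mollifiers.

(** * Truncation error of the mollifier *)

Section MollifierTail.
Context {R : realType} {d : nat}.
Local Notation E := 'rV[R]_d.
Local Notation C := R[i].
Implicit Types (f g h k rho chi : E -> C) (U K Omega : set E) (x y w z : E).
Implicit Types (i j : 'I_d) (s t : seq 'I_d).
Local Notation normc := Normc.normc.

Lemma smooth_scale f (c : R) : smooth setT f -> smooth setT (fun z => f (c *: z)).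
Proof.
move=> sf; rewrite (_ : (fun z => _) = fun z => f (c *: z + 0)).
  exact: smooth_affine.
by apply/funext => z; rewrite addr0.
Qed.

Lemma cpartials_scale f (c : R) s z : smooth setT f ->
  cpartials s (fun z => f (c *: z)) z = (c ^+ size s)%:C * cpartials s f (c *: z).
Proof.
move=> sf; rewrite (_ : (fun z => _) = fun z => f (c *: z + 0)); last first.
  by apply/funext => y; rewrite addr0.
by rewrite (cpartials_affine c 0 s sf) addr0.
Qed.

Lemma smooth_rho_eps rho (e : R) : smooth setT rho -> smooth setT (rho_eps rho e).
Proof.
by move=> srho; apply: smoothM; [exact: smooth_cst|exact: smooth_scale].
Qed.

Lemma smooth_theta_eps rho chi (e : R) : smooth setT rho -> smooth setT chi ->
  smooth setT (theta_eps rho chi e).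
Proof.
move=> srho schi; rewrite /theta_eps.
case: (e == 1); first exact: smooth_cst.
by apply: smoothM; [exact: smooth_rho_eps|exact: smooth_scale].
Qed.

Lemma cpartials_rho_eps rho (e : R) s z : smooth setT rho ->
  cpartials s (rho_eps rho e) z =
  (e ^- d * e ^- size s)%:C * cpartials s rho (e^-1 *: z).
Proof.
move=> srho; rewrite /rho_eps.
have sc := smooth_scale e^-1 srho.
have -> : (fun x => (e ^- d)%:C * rho (e^-1 *: x)) =
    fun x => (e ^- d)%:C * rho (e^-1 *: x) + (fun=> 0) x.
  by apply/funext => x; rewrite addr0.
rewrite (cpartials_linear _ s openT sc (@smooth_cst _ _ 0))// cpartials_0 addr0.
by rewrite (cpartials_scale _ s z srho) mulrA -rmorphM /= exprVn.
Qed.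

Lemma rho_eps_bound rho n : schwartz rho ->
  exists2 M : R, 0 <= M & forall (e : R) s z, 0 < e <= 1 -> (size s <= n)%N ->
    normc (cpartials s (rho_eps rho e) z) <= M * e ^- (d + n).
Proof.
move=> Hrho; have [M M0 HM] := schwartz_decay 0 n Hrho.
exists M => // e s z /andP[e0 e1] sn.
rewrite (cpartials_rho_eps e s z Hrho.1) Normc.normcM normc_real mulrC.
have p0 m : 0 <= e ^- m by rewrite invr_ge0 exprn_ge0// ltW.
have := HM s (e^-1 *: z) sn; rewrite expr0 mul1r => h.
apply: ler_pM => //; first exact: normc_ge0.
rewrite ger0_norm; last exact: mulr_ge0.
rewrite -invfM -exprD lef_pV2 ?posrE ?exprn_gt0//.
by apply: ler_wiXn2l; [exact: ltW|exact: e1|rewrite leq_add2l].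
Qed.

(** The factor 1 - chi is not compactly supported, but only its undifferentiated
    value sees the constant. *)
Lemma cutoff_part_bound chi n : plateau chi ->
  exists2 M : R, 0 <= M & forall (L : R) s z, 1 <= L -> (size s <= n)%N ->
    normc (cpartials s (fun z => chi (L *: z) - 1) z) <= M * L ^+ n.
Proof.
move=> [tchi _ _ _]; have schi : smooth setT chi by case: tchi.
have [M M0 HM] := testfun_partials_bound n tchi.
exists (M + 1); first by rewrite addr_ge0.
move=> L s z L1 sn.
have sc := smooth_scale L schi.
rewrite (cpartialsB s openT sc (@smooth_cst _ _ 1))//.
apply: (le_trans (normcB_le _ _)); rewrite mulrDl mul1r; apply: lerD.
  rewrite (cpartials_scale _ s z schi) Normc.normcM normc_real mulrC.
  apply: ler_pM; [exact: normc_ge0|exact: normr_ge0|exact: HM|].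
  rewrite ger0_norm ?exprn_ge0 ?(le_trans ler01)//.
  exact: ler_weXn2l.
apply: (le_trans (normc_cpartials_1 s z)); exact: exprn_ege1.
Qed.

Lemma theta_sub_rho rho chi (e : R) : e != 1 ->
  (fun z => theta_eps rho chi e z - rho_eps rho e z) =
  (fun z => rho_eps rho e z * (chi (`|ln e| *: z) - 1)).
Proof.
by move=> e1; apply/funext => z; rewrite /theta_eps (negbTE e1) mulrBr mulr1.
Qed.

Lemma expR_N1_lt1 : expR (-1) < 1 :> R.
Proof. by rewrite expR_lt1 ltrN10. Qed.

(** Write theta_e - rho_e = rho_e (chi(L .) - 1) with L = |ln e|.  The second factor
    vanishes near z unless |z| >= 1 / (c L) for a constant c, and then
    |z / e| >= 1 / (c L e), so the rapid decay of rho brings a factor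
    (c L e) ^ (2 r), which is O(e ^ r).  The scalings by 1 / e and by L cost at
    most e ^ - (d + n) and e ^ - n. *)
Lemma mollifier_tail rho chi n p : schwartz rho -> plateau chi ->
  exists2 M : R, 0 <= M & forall (e : R) s z, 0 < e <= expR (-1) -> (size s <= n)%N ->
    normc (cpartials s (fun z => theta_eps rho chi e z - rho_eps rho e z) z) <= M * e ^+ p.
Proof.
move=> Hrho Hchi.
(* The decay e ^ r has to pay for e ^ - (d + n) from rho_e, for L ^ n <= e ^ - n, and
   to leave e ^ p. *)
pose r := (p + (d + n) + n)%N.
have [M1 M10 HM1] := schwartz_decay (2 * r) n Hrho.
have [M2 M20 HM2] := cutoff_part_bound n Hchi.
have [tchi _ chi1 _] := Hchi; have schi : smooth setT chi by case: tchi.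
pose c := Num.sqrt (d%:R : R) + 1.
have c0 : 0 < c by rewrite ltr_wpDl// sqrtr_ge0.
pose M := 2 ^+ n * (c ^+ (2 * r) * 4 ^+ r) * M1 * M2.
have M0 : 0 <= M by rewrite !mulr_ge0// ?exprn_ge0// ltW.
exists M => // e s z /andP[e0 eN1] sn.
have e1 : e < 1 by exact: le_lt_trans eN1 expR_N1_lt1.
have L1 := abs_ln_ge1 e0 eN1.
have Li := abs_ln_le_inv e0 eN1.
have Le := abs_lnM_sqr e0 eN1.
rewrite theta_sub_rho ?lt_eqF//.
move: (`|ln e|) L1 Li Le => L L1 Li Le.
have L0 : 0 < L by rewrite (lt_le_trans ltr01).
have cL0 : 0 < c * L by rewrite mulr_gt0.
have [zs|zl] := ltP `|z| (c * L)^-1.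
  (* The norm of E is the sup norm: c bounds the Euclidean norm in terms of it,
     so chi (L *: z) = 1 around every such z and all derivatives vanish. *)
  have oU : open (ball (0 : E) (c * L)^-1) by apply: ball_open; rewrite invr_gt0.
  have Uz : ball (0 : E) (c * L)^-1 z by rewrite -ball_normE /= sub0r normrN.
  have f0 y : ball (0 : E) (c * L)^-1 y ->
      rho_eps rho e y * (chi (L *: y) - 1) = (fun=> 0) y.
    rewrite -ball_normE /= sub0r normrN => ys.
    rewrite chi1 ?subrr ?mulr0//.
    apply: (le_trans (enorm_le _)); rewrite normrZ (gtr0_norm L0) mulrA.
    apply: (@le_trans _ _ (c * L * `|y|)).
      apply: ler_wpM2r => //; apply: ler_wpM2r; first exact: ltW.
      by rewrite lerDl.
    by rewrite -ler_pdivlMl// mulr1 ltW.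
  rewrite (eq_cpartials_open s oU f0 Uz) cpartials_0 Normc.normc0.
  by rewrite mulr_ge0// exprn_ge0// ltW.
have p0 m : 0 <= e ^- m by rewrite invr_ge0 exprn_ge0// ltW.
have A0 : 0 <= e ^- (d + n) * ((c * L * e) ^+ (2 * r) * M1).
  by rewrite !mulr_ge0 ?invr_ge0 ?exprn_ge0// ?mulr_ge0// ltW.
have B0 : 0 <= M2 * L ^+ n by rewrite mulr_ge0// exprn_ge0// ltW.
have sc : smooth setT (fun z => chi (L *: z) - 1).
  by apply: smoothB openT _ (@smooth_cst _ _ 1); exact: smooth_scale.
have HA t : (size t <= size s)%N ->
    normc (cpartials t (rho_eps rho e) z) <= e ^- (d + n) * ((c * L * e) ^+ (2 * r) * M1).
  move=> ts; have tn := leq_trans ts sn.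
  rewrite (cpartials_rho_eps e t z Hrho.1) Normc.normcM normc_real.
  apply: ler_pM; [exact: normr_ge0|exact: normc_ge0| |].
    rewrite ger0_norm; last exact: mulr_ge0.
    rewrite -invfM -exprD lef_pV2 ?posrE ?exprn_gt0//.
    by apply: ler_wiXn2l; [exact: ltW|exact: ltW|rewrite leq_add2l].
  have := HM1 t (e^-1 *: z) tn.
  set a := normc _ => H.
  have w1 : 1 <= c * L * e * `|e^-1 *: z|.
    rewrite normrZ gtr0_norm ?invr_gt0// mulrA mulfK ?gt_eqF//.
    by rewrite -ler_pdivrMl// mulr1.
  apply: (@le_trans _ _ ((c * L * e * `|e^-1 *: z|) ^+ (2 * r) * a)).
    by rewrite ler_peMl ?normc_ge0// exprn_ege1.
  rewrite exprMn -[leLHS]mulrA; apply: ler_wpM2l => //.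
  by rewrite exprn_ge0// mulr_ge0// ltW.
have HB t : (size t <= size s)%N ->
    normc (cpartials t (fun z => chi (L *: z) - 1) z) <= M2 * L ^+ n.
  by move=> ts; apply: HM2 => //; exact: leq_trans ts sn.
apply: (le_trans (leibniz_bound (smooth_rho_eps e Hrho.1) sc A0 B0 HA HB)).
apply: (@le_trans _ _ (2 ^+ n * (e ^- (d + n) * ((c ^+ (2 * r) * (4 * e) ^+ r) * M1) *
    (M2 * e ^- n)))).
  apply: ler_pM.
  - exact: exprn_ge0.
  - exact: mulr_ge0.
  - by rewrite ler_weXn2l// ler1n.
  apply: ler_pM => //.
    apply: ler_wpM2l; first by rewrite invr_ge0 exprn_ge0// ltW.
    apply: ler_wpM2r => //.
    rewrite -mulrA exprMn; apply: ler_wpM2l; first by rewrite exprn_ge0// ltW.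
    rewrite exprM; apply: lerXn2r; rewrite ?nnegrE ?sqr_ge0//.
    by rewrite mulr_ge0// ltW.
  apply: ler_wpM2l => //; rewrite -exprVn; apply: lerXn2r => //.
    by rewrite nnegrE ltW.
  by rewrite nnegrE invr_ge0 ltW.
have -> : (4 * e) ^+ r = 4 ^+ r * (e ^+ p * e ^+ (d + n) * e ^+ n).
  by rewrite exprMn /r !exprD.
rewrite le_eqVlt; apply/orP; left; apply/eqP; rewrite /M.
have h1 : e ^+ (d + n) != 0 by rewrite expf_neq0// gt_eqF.
have h2 : e ^+ n != 0 by rewrite expf_neq0// gt_eqF.
move: (e ^+ (d + n)) (e ^+ n) (e ^+ p) (c ^+ (2 * r)) (4 ^+ r) (2 ^+ n) h1 h2.
by move=> a1 a2 a3 a4 a5 a6 h1 h2; field; rewrite ?h1 ?h2.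
Qed.

Lemma theta_eps_support rho chi (e : R) z : plateau chi -> e != 1 ->
  theta_eps rho chi e z != 0 -> `|ln e| * `|z| < 2.
Proof.
move=> [_ _ _ chi0] e1; rewrite /theta_eps (negbTE e1) => h.
rewrite ltNge; apply/negP => Lz; move: h; rewrite chi0 ?mulr0 ?eqxx//.
by apply: le_trans (enorm_ge _); rewrite normrZ normr_id.
Qed.

(** The support shrinks like 2 / |ln e|. *)
Lemma theta_eps_small_support rho chi (r : R) : plateau chi -> 0 < r ->
  exists2 e1 : R, 0 < e1 < 1 & forall (e : R) z, 0 < e <= e1 ->
    theta_eps rho chi e z != 0 -> `|z| < r.
Proof.
move=> Hchi r0; exists (expR (- (2 / r))).
  by rewrite expR_gt0/= expR_lt1 oppr_lt0 divr_gt0.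
move=> e z /andP[e0 e1].
have lne : ln e <= - (2 / r) by rewrite -[leRHS]expRK ler_ln ?posrE ?expR_gt0.
have r20 : 0 < 2 / r by rewrite divr_gt0.
have L2 : 2 / r <= `|ln e| by rewrite ler0_norm; lra.
have en1 : e != 1.
  by rewrite lt_eqF// (le_lt_trans e1)// expR_lt1 oppr_lt0.
move=> /(theta_eps_support Hchi en1) h.
have : 2 / r * `|z| < 2 by apply: le_lt_trans h; exact: ler_wpM2r.
by rewrite mulrAC ltr_pdivrMr// ltr_pM2l.
Qed.

End MollifierTail.

(** * Exhaustion of the open set and local comparison *)

Section Exhaustion.
Context {R : realType} {d : nat}.
Local Notation E := 'rV[R]_d.
Local Notation C := R[i].
Implicit Types (f g h k rho chi : E -> C) (U K W Omega : set E) (x y w z : E).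
Implicit Types (i j : 'I_d) (s t : seq 'I_d).
Local Notation normc := Normc.normc.

(** Uniformity in e and in z near x is what makes compactness applicable. *)
Lemma exhaustion_near Omega x : open Omega -> Omega x ->
  exists2 r : R, 0 < r & forall e z, 0 < e <= r -> ball x r z -> exhaustion Omega e z.
Proof.
move=> oO Ox.
have /nbhs_ballP[r0 /= r00 Hr0] := open_nbhs_nbhs (conj oO Ox).
pose c := (Num.sqrt (d%:R : R) + 1) * (`|x| + 1).
have c0 : 0 < c.
  by rewrite mulr_gt0// ltr_wpDl// sqrtr_ge0.
pose r := Num.min (r0 / 2) (Num.min 1 c^-1).
have r_gt0 : 0 < r by rewrite !lt_min divr_gt0//= ltr01 invr_gt0.
have [rr0 r1 rc] : [/\ r <= r0 / 2, r <= 1 & r <= c^-1].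
  by rewrite /r !ge_min !lexx !orbT.
exists r => // e z /andP[e0 er].
rewrite -ball_normE /= => xz; split.
- apply: Hr0; rewrite -ball_normE /=; apply: (lt_le_trans xz).
  by apply: (le_trans rr0); rewrite ler_pdivrMr// ler_peMr ?ler1n// ltW.
- apply: le_ereal_inf_tmp => _ [y nOy <-].
  rewrite lee_fin (le_trans er)// leNgt; apply/negP => yz; apply: nOy.
  apply: Hr0; rewrite -ball_normE /=.
  have -> : x - y = (x - z) + (z - y) by rewrite addrA subrK.
  apply: (le_lt_trans (ler_normD _ _)); rewrite [r0]splitr; apply: ltrD.
    exact: lt_le_trans xz rr0.
  exact: le_lt_trans (enorm_ge _) (lt_le_trans yz rr0).
- apply: (le_trans (enorm_le _)).
  have z1 : `|z| <= `|x| + 1.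
    rewrite -[z in leLHS](subrK x) addrC; apply: (le_trans (ler_normD _ _)).
    by apply: lerD => //; rewrite distrC ltW// (lt_le_trans xz).
  apply: (@le_trans _ _ c).
    by apply: ler_pM; rewrite ?sqrtr_ge0// lerDl.
  by rewrite -[leLHS]invrK lef_pV2 ?posrE ?invr_gt0//; exact: le_trans er rc.
Qed.

(** A Lebesgue number argument. *)
Lemma compact_uniform_radius K (Q : R -> E -> Prop) : compact K ->
  (forall x, K x -> exists2 r : R, 0 < r & forall e z, 0 < e <= r -> ball x r z -> Q e z) ->
  exists2 r : R, 0 < r & forall x e z, K x -> 0 < e <= r -> ball x r z -> Q e z.
Proof.
move=> cK H.
have : \forall r \near (0 : R)^'+, K `<=` [set x | forall e z, 0 < e <= r -> ball x r z -> Q e z].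
  apply: ((compact_near_coveringP K).1 cK R ((0 : R)^'+)
    (fun r x => forall e z, 0 < e <= r -> ball x r z -> Q e z)) => x Kx.
  have [r r0 Hr] := H x Kx; have r20 : 0 < r / 2 by rewrite divr_gt0.
  exists (ball x (r / 2), [set r' : R | r' <= r / 2]).
    by split => /=; [exact: nbhsx_ballx|exact: nbhs_right_le].
  move=> [x' r'] /= [xx' rr'] e z /andP[e0 er'] x'z; apply: Hr.
    by rewrite e0 (le_trans er')// (le_trans rr')//; move: r0; clear; lra.
  by have := ball_triangle xx' (le_ball rr' x'z); rewrite -splitr.
move=> near1.
have near2 : \forall r \near (0 : R)^'+, 0 < r by exact: nbhs_right_gt.
have [r [h1 h2]] := filter_ex (filterI near1 near2).
by exists r => // x e z Kx; exact: h1.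
Qed.

(** The sets K_e exhaust Omega, so near a compact set the cutoffs with small
    parameter equal 1, at a uniform distance. *)
Lemma cutoffs_eventually_one Omega kappa K : open Omega -> exhaustion_cutoffs Omega kappa ->
  compact K -> K `<=` Omega ->
  exists2 r : R, 0 < r <= 1 & forall x e z, K x -> 0 < e <= r -> ball x r z -> kappa e z = 1.
Proof.
move=> oO Hk cK KO.
have [r r0 Hr] := @compact_uniform_radius K (exhaustion Omega) cK
  (fun x Kx => exhaustion_near oO (KO x Kx)).
have r10 : 0 < Num.min r 1 by rewrite lt_min r0 ltr01.
exists (Num.min r 1); first by rewrite r10 ge_min lexx orbT.
move=> x e z Kx /andP[e0]; rewrite le_min => /andP[er e1] xz.
have [_ _] := Hk e (introT andP (conj e0 e1)); apply.
apply: (Hr x) => //; first by rewrite e0.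
by apply: le_ball xz; rewrite ge_min lexx.
Qed.

Lemma eq_convolution_cutoff Omega (T : schwartz_distribution Omega) k1 k2 g x :
  (forall y, g (x - y) != 0 -> k1 y = k2 y) ->
  convolution (cutoff k1 T) g x = convolution (cutoff k2 T) g x.
Proof.
move=> H; rewrite /convolution /cutoff; congr (T _); apply/funext => y.
by have [->|/H ->//] := eqVneq (g (x - y)) 0; rewrite !mulr0.
Qed.

Lemma eq_convolution_pairing Omega (T : schwartz_distribution Omega) k g x :
  (forall y, g (x - y) != 0 -> k y = 1) ->
  convolution T g x = convolution (cutoff k T) g x.
Proof.
move=> H; rewrite /convolution /cutoff; congr (pairing T _); apply/funext => y.
by have [->|/H ->] := eqVneq (g (x - y)) 0; rewrite ?mulr0// mul1r.
Qed.

Lemma supp_reflect f x z : supp f z -> supp (fun y => f (x - y)) (x - z).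
Proof.
move=> fz B /nbhs_ballP[r /= r0 Hr].
have [w [/= fw zw]] := fz _ (nbhsx_ballx z r r0).
exists (x - w); split; first by rewrite /= opprB addrC subrK.
apply: Hr; move: zw; rewrite -!ball_normE /=.
have -> : x - z - (x - w) = w - z by rewrite opprB addrC addrA subrK.
by rewrite distrC.
Qed.

Lemma supp_theta_compact rho chi (e : R) : plateau chi -> 0 < e < 1 ->
  compact (supp (theta_eps rho chi e)).
Proof.
move=> Hchi /andP[e0 e1].
have L0 : 0 < `|ln e| by rewrite normr_gt0 lt_eqF// ln_lt0// e0.
apply: subclosed_compact (@closed_supp _ _ _) (@closed_ball0_compact R d (2 / `|ln e|)) _.
have cl : closed [set z : E | `|z| <= 2 / `|ln e|].
  exact: compact_closed (@norm_hausdorff _ _) (@closed_ball0_compact R d _).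
rewrite ((closure_id _).1 cl).
apply: closure_subset => z /= hz.
have e1' : e != 1 by rewrite lt_eqF.
have := theta_eps_support Hchi e1' hz.
by rewrite ler_pdivlMr// mulrC => /ltW.
Qed.

(** The function x |-> T(theta_e(x - .)) is locally a convolution with a compactly
    supported distribution: when x0 is in W, the compact set x0 - supp theta_e lies in
    Omega, and a cutoff kappa_e' with e' small equals 1 on x - supp theta_e for all x
    near x0. *)
Lemma smooth_pairing_theta Omega rho chi kappa W (e : R) (T : schwartz_distribution Omega) :
  open Omega -> schwartz rho -> plateau chi -> exhaustion_cutoffs Omega kappa ->
  open W -> 0 < e < 1 ->
  (forall x, W x -> supp (fun y => theta_eps rho chi e (x - y)) `<=` Omega) ->
  smooth W (convolution T (theta_eps rho chi e)).
Proof.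
move=> oO Hrho Hchi Hk oW He HW.
have [[schi _ _] _ _ _] := Hchi.
have sth : smooth setT (theta_eps rho chi e) := smooth_theta_eps e Hrho.1 schi.
have cS := @supp_theta_compact rho chi e Hchi He.
move=> s x0 Wx0.
(* A cutoff that works for all x near x0, by compactness of supp theta_e. *)
have : \forall p \near filter_prod (nbhs x0) (0 : R)^'+,
    supp (theta_eps rho chi e) `<=` [set z | exhaustion Omega p.2 (p.1 - z)].
  apply: ((compact_near_coveringP _).1 cS (E * R)%type (filter_prod (nbhs x0) (0 : R)^'+)
    (fun p z => exhaustion Omega p.2 (p.1 - z))) => z Sz.
  have Oxz : Omega (x0 - z) by apply: (HW x0 Wx0); exact: supp_reflect.
  have [r r0 Hr] := exhaustion_near oO Oxz; have r20 : 0 < r / 2 by rewrite divr_gt0.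
  exists (ball z (r / 2), [set p : E * R | ball x0 (r / 2) p.1 /\ 0 < p.2 <= r]).
    split => /=; first exact: nbhsx_ballx.
    exists (ball x0 (r / 2), [set e' : R | 0 < e' <= r]).
      split => /=; first exact: nbhsx_ballx.
      have h1 := nbhs_right_gt (0 : R); have h2 := nbhs_right_le r0.
      by apply: filterS2 h1 h2 => e' /= -> ->.
    by move=> [x' e'].
  move=> [z' [x' e']] /= [zz' [xx' he']]; apply: Hr => //.
  move: zz' xx'; rewrite -!ball_normE /= => zz' xx'.
  have -> : x0 - z - (x' - z') = (x0 - x') - (z - z').
    by rewrite !opprB [z' - x']addrC addrACA [- z + z']addrC.
  by rewrite [r]splitr; apply: (le_lt_trans (ler_normB _ _)); exact: ltrD.
move=> [[A B] /= [nA nB] AB].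
have near1 : \forall e' \near (0 : R)^'+, 0 < e' by exact: nbhs_right_gt.
have near2 : \forall e' \near (0 : R)^'+, e' <= 1 by exact: nbhs_right_le.
have [e' [Be' [e'0 e'1]]] := filter_ex (filterI nB (filterI near1 near2)).
have [/= tk _ k1] := Hk e' (introT andP (conj e'0 e'1)).
have /nbhs_ballP[r /= r0 Hr] := nA.
have oB : open (ball x0 r) by exact: ball_open.
have eqB x : ball x0 r x -> convolution (cutoff (kappa e') T) (theta_eps rho chi e) x =
    convolution T (theta_eps rho chi e) x.
  move=> /Hr Ax; symmetry; apply: eq_convolution_pairing => y hy; apply: k1.
  have /= := AB (x, e') (conj Ax Be') _ (supp_sub hy).
  by rewrite opprB addrC subrK.
have sc : smooth (ball x0 r) (convolution (cutoff (kappa e') T) (theta_eps rho chi e)).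
  exact: smooth_subset (@subsetT _ _) (smooth_convolution T tk sth).
have H := eq_smooth_open oB eqB sc.
by have := H s x0 (ballxx x0 r0).
Qed.

(** For small e the support of theta_e(x - .) lies where both kappa_e and k equal 1,
    for all x near K.  There the difference is (k T) convolved with
    theta_e - rho_e, all of whose derivatives are O(e ^ p). *)
Lemma theta_rho_difference Omega rho chi kappa k K (T : schwartz_distribution Omega) (r : R) l p :
  open Omega -> schwartz rho -> plateau chi -> exhaustion_cutoffs Omega kappa ->
  compact K -> K `<=` Omega -> testfun Omega k -> 0 < r ->
  (forall x z, K x -> ball x r z -> k z = 1) ->
  exists2 M : R, 0 <= M & \forall e \near (0 : R)^'+, forall s x,
    (size s <= l)%N -> K x ->
    normc (cpartials s (fun x => convolution (cutoff (kappa e) T) (theta_eps rho chi e) x -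
        convolution (cutoff k T) (rho_eps rho e) x) x) <= M * e ^+ p.
Proof.
move=> oO Hrho Hchi Hk cK KO tk r0 k1.
have [[schi _ _] _ _ _] := Hchi.
have [M [N [M0 HM]]] := distribution_bound T tk.
have [M' M'0 HM'] := mollifier_tail (N + l) p Hrho Hchi.
have [r1 /andP[r10 r11] Hr1] := cutoffs_eventually_one oO Hk cK KO.
pose r2 := Num.min r r1.
have r20 : 0 < r2 by rewrite lt_min r0.
have [r2r r2r1] : r2 <= r /\ r2 <= r1 by rewrite /r2 !ge_min !lexx orbT.
have r220 : 0 < r2 / 2 by rewrite divr_gt0.
have [e1 /andP[e10 e11] He1] := theta_eps_small_support rho Hchi r220.
exists (M * M'); first exact: mulr_ge0.
have n1 : \forall e \near (0 : R)^'+, 0 < e by exact: nbhs_right_gt.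
have n2 : \forall e \near (0 : R)^'+, e <= e1 by exact: nbhs_right_le.
have n3 : \forall e \near (0 : R)^'+, e <= r1 by exact: nbhs_right_le.
have n4 : \forall e \near (0 : R)^'+, e <= expR (-1).
  by apply: nbhs_right_le; exact: expR_gt0.
apply: filterS (filterI (filterI n1 n2) (filterI n3 n4)) => e [[e0 ee1] [er1 eN1]] s x sl Kx.
have sth : smooth setT (theta_eps rho chi e) := smooth_theta_eps e Hrho.1 schi.
have srh : smooth setT (rho_eps rho e) := smooth_rho_eps e Hrho.1.
pose q z := theta_eps rho chi e z - rho_eps rho e z.
have sq : smooth setT q by exact: smoothB openT sth srh.
have oB : open (ball x (r2 / 2)) by exact: ball_open.
have eqB x' : ball x (r2 / 2) x' ->
    convolution (cutoff (kappa e) T) (theta_eps rho chi e) x' -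
        convolution (cutoff k T) (rho_eps rho e) x' = convolution (cutoff k T) q x'.
  move=> xx'.
  rewrite (@eq_convolution_cutoff _ T (kappa e) k); last first.
    move=> y hy.
    have xy : ball x r2 y.
      have x'y : ball x' (r2 / 2) y.
        by rewrite -ball_normE /=; apply: (He1 e) => //; rewrite e0.
      by have := ball_triangle xx' x'y; rewrite -splitr.
    rewrite (k1 x y Kx (le_ball r2r xy)).
    by rewrite (Hr1 x e y Kx _ (le_ball r2r1 xy))// e0.
  rewrite /q (_ : (fun z => _) = fun z => (-1) * rho_eps rho e z + theta_eps rho chi e z).
    by rewrite (convolution_linear T (-1) x' tk srh sth) mulN1r addrC.
  by apply/funext => z; rewrite mulN1r addrC.
rewrite (eq_cpartials_open s oB eqB (ballxx x r220)).
rewrite (cpartials_convolution T s tk sq) -mulrA.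
apply: HM.
- exact: smooth_cpartials.
- by rewrite mulr_ge0// exprn_ge0// ltW.
- move=> t y tN ky; rewrite -cpartials_cat; apply: HM'; first by rewrite e0.
  by rewrite size_cat leq_add.
Qed.

Lemma convolution_rho_moderate Omega rho k (T : schwartz_distribution Omega) l :
  schwartz rho -> testfun Omega k ->
  exists (M : R) (q : nat), 0 <= M /\ forall (e : R) s x, 0 < e <= 1 -> (size s <= l)%N ->
    normc (cpartials s (convolution (cutoff k T) (rho_eps rho e)) x) <= M * e ^- q.
Proof.
move=> Hrho tk.
have [M [N [M0 HM]]] := distribution_bound T tk.
have [M' M'0 HM'] := rho_eps_bound (N + l) Hrho.
exists (M * M'), (d + (N + l))%N; split; first exact: mulr_ge0.
move=> e s x He sl; have /andP[e0 e1] := He.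
have srh : smooth setT (rho_eps rho e) := smooth_rho_eps e Hrho.1.
rewrite (cpartials_convolution T s tk srh) -mulrA; apply: HM.
- exact: smooth_cpartials.
- by rewrite mulr_ge0// invr_ge0 exprn_ge0// ltW.
- move=> t y tN ky; rewrite -cpartials_cat; apply: HM' => //.
  by rewrite size_cat leq_add.
Qed.

End Exhaustion.

(** * The quotient algebra *)

Section Quotient.
Context {R : realType} {d : nat}.
Local Notation E := 'rV[R]_d.
Local Notation C := R[i].
Local Notation negligible := Defs.negligible.
Implicit Types (U V K : set E) (x y z : E) (f g h : net (R := R) (d := d)).
Local Notation normc := Normc.normc.

Lemma closed_ball_norm_compact x (r : R) : compact [set z : E | `|x - z| <= r].
Proof.
apply: (subclosed_compact _ (@closed_ball0_compact R d (`|x| + r))).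
  apply: (@closed_comp _ _ (fun z : E => `|x - z|) [set x | x <= r]) => //.
  move=> z _; apply: (@continuous_comp _ _ _ (fun z : E => x - z) (fun w : E => `|w|)).
    by apply: continuousB; [exact: cst_continuous|move=> ?; exact: cvg_id].
  exact: norm_continuous.
move=> z /= xz; rewrite -[z](subKr x); apply: (le_trans (ler_normB _ _)).
by apply: lerD.
Qed.

Lemma near_unit_interval : \forall e \near (0 : R)^'+, 0 < e <= 1.
Proof.
have n1 : \forall e \near (0 : R)^'+, 0 < e by exact: nbhs_right_gt.
have n2 : \forall e \near (0 : R)^'+, e <= 1 by exact: nbhs_right_le.
by apply: filterS2 n1 n2 => e -> ->.
Qed.

(** A bound O(e ^ (p + 1)) gives o(e ^ p), so pointwise big-O bounds of every order
    suffice. *)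
Lemma negligible_intro U f : smooth_net U f ->
  (forall l K p, compact K -> K `<=` U -> exists M : R, \forall e \near (0 : R)^'+,
     forall a x, (mdeg a <= l)%N -> K x -> normc (mpartial a (f e) x) <= M * e ^+ p) ->
  negligible U f.
Proof.
move=> sf H; split=> // l K cK KU p; apply/eqoP => c c0.
have [M HM] := H l K p.+1 cK KU.
have M1 : 0 < `|M| + 1 by rewrite ltr_wpDl.
have n1 : \forall e \near (0 : R)^'+, e <= c / (`|M| + 1).
  by apply: nbhs_right_le; rewrite divr_gt0.
apply: filterS (filterI near_unit_interval (filterI HM n1)) => e [/[dup] He /andP[e0 e1] [HMe ec]].
have sn : seminorm K l (f e) <= c * e ^+ p.
  apply: seminorm_le; first by rewrite mulr_ge0 ?exprn_ge0// ltW.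
  move=> a x al Kx; apply: (le_trans (HMe a x al Kx)).
  rewrite exprS mulrA; apply: ler_wpM2r; first by rewrite exprn_ge0// ltW.
  apply: (@le_trans _ _ ((`|M| + 1) * e)); last by rewrite mulrC -ler_pdivlMr.
  by apply: ler_wpM2r; [exact: ltW|rewrite (le_trans (ler_norm _))// lerDl].
rewrite ger0_norm; last exact: seminorm_ge0 cK KU (sf e He).
by rewrite [`|e ^+ p|]ger0_norm// exprn_ge0// ltW.
Qed.

Lemma moderate_intro U f : smooth_net U f ->
  (forall l K, compact K -> K `<=` U -> exists (M : R) (q : nat),
     \forall e \near (0 : R)^'+,
     forall a x, (mdeg a <= l)%N -> K x -> normc (mpartial a (f e) x) <= M * e ^- q) ->
  moderate U f.
Proof.
move=> sf H; split=> // l K cK KU; have [M [q HM]] := H l K cK KU.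
exists q.+1; apply/eqoP => c c0.
have M1 : 0 < `|M| + 1 by rewrite ltr_wpDl.
have n1 : \forall e \near (0 : R)^'+, e <= c / (`|M| + 1).
  by apply: nbhs_right_le; rewrite divr_gt0.
apply: filterS (filterI near_unit_interval (filterI HM n1)) => e [/[dup] He /andP[e0 e1] [HMe ec]].
have p0 m : 0 <= e ^- m by rewrite invr_ge0 exprn_ge0// ltW.
have sn : seminorm K l (f e) <= c * e ^- q.+1.
  apply: seminorm_le; first by rewrite mulr_ge0// ltW.
  move=> a x al Kx; apply: (le_trans (HMe a x al Kx)).
  rewrite exprS invfM mulrA; apply: ler_wpM2r => //.
  rewrite ler_pdivlMr//; apply: (@le_trans _ _ ((`|M| + 1) * e)); last first.
    by rewrite mulrC -ler_pdivlMr.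
  by apply: ler_wpM2r; [exact: ltW|rewrite (le_trans (ler_norm _))// lerDl].
rewrite ger0_norm; last exact: seminorm_ge0 cK KU (sf e He).
by rewrite [`|e ^- _|]ger0_norm.
Qed.

Lemma negligible_elim U f l K p : negligible U f -> compact K -> K `<=` U ->
  \forall e \near (0 : R)^'+,
     forall a x, (mdeg a <= l)%N -> K x -> normc (mpartial a (f e) x) <= e ^+ p.
Proof.
move=> [sf /(_ l K)Hf] cK KU; have /eqoP/(_ _ ltr01) := Hf cK KU p.
move=> Hn; apply: filterS2 near_unit_interval Hn => e He.
rewrite mul1r [`|e ^+ p|]ger0_norm; last by case/andP: He => e0 _; rewrite exprn_ge0// ltW.
move=> h a x al Kx.
apply: (le_trans (le_seminorm cK KU (sf e He) al Kx)).
exact: le_trans (ler_norm _) h.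
Qed.

Lemma smooth_netB U f g : open U -> smooth_net U f -> smooth_net U g ->
  smooth_net U (fun e x => f e x - g e x).
Proof. by move=> oU sf sg e He; exact: smoothB oU (sf e He) (sg e He). Qed.

Lemma negligibleB U f g : open U -> negligible U f -> negligible U g ->
  negligible U (fun e x => f e x - g e x).
Proof.
move=> oU nf ng; have [sf _] := nf; have [sg _] := ng.
apply: negligible_intro; first exact: smooth_netB.
move=> l K p cK KU; exists 2.
have n1 := negligible_elim l p nf cK KU; have n2 := negligible_elim l p ng cK KU.
apply: filterS (filterI near_unit_interval (filterI n1 n2)) => e [He [h1 h2]] a x al Kx.
rewrite /mpartial (cpartialsB _ oU (sf e He) (sg e He) (KU x Kx)).
apply: (le_trans (normcB_le _ _)); rewrite mulrDl mul1r; apply: lerD.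
  exact: h1.
exact: h2.
Qed.

Lemma negligible_refl U f : negligible U (fun e x => f e x - f e x).
Proof.
have -> : (fun e x => f e x - f e x) = net0.
  by apply/funext => e; apply/funext => x; rewrite subrr.
apply: negligible_intro; first by have [] := @moderate_0 R d U.
move=> l K p _ _; exists 0; apply: nearW => e a x _ _.
by rewrite /mpartial cpartials_0 Normc.normc0 mul0r.
Qed.

Lemma negligible_subset U V f : V `<=` U -> negligible U f -> negligible V f.
Proof.
move=> VU [sf Hf]; split.
  by move=> e He; exact: smooth_subset VU (sf e He).
by move=> l K cK KV; apply: Hf => //; exact: subset_trans KV VU.
Qed.

Lemma moderate_subset U V f : V `<=` U -> moderate U f -> moderate V f.
Proof.
move=> VU [sf Hf]; split.
  by move=> e He; exact: smooth_subset VU (sf e He).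
by move=> l K cK KV; apply: Hf => //; exact: subset_trans KV VU.
Qed.

Lemma negligible_sym U f g : open U -> negligible U (fun e x => f e x - g e x) ->
  negligible U (fun e x => g e x - f e x).
Proof.
move=> oU nfg.
have := negligibleB oU (negligible_refl U f) nfg.
congr negligible; apply/funext => e; apply/funext => x.
by rewrite subrr sub0r opprB.
Qed.

(** Negligibility is local: every point of K has a compact ball inside a member of
    the cover, and compactness makes the thresholds in e uniform. *)
Lemma negligible_cover U (L : Type) (W : L -> set E) f :
  (forall l, open (W l)) -> \bigcup_l W l = U ->
  (forall l, negligible (W l) f) -> negligible U f.
Proof.
move=> oW WU nW; apply: negligible_intro.
  move=> e He s x; rewrite -WU => -[l _ Wx].
  by have [/(_ e He s x Wx)] := nW l.
move=> l K p cK KU; exists 1.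
have cov : \forall e \near (0 : R)^'+, K `<=` [set x | forall a : multi_index d,
    (mdeg a <= l)%N -> normc (mpartial a (f e) x) <= e ^+ p]; last first.
  move: cov; apply: (@filterS _ (0 : R)^'+ _) => e He a x al Kx.
  by rewrite mul1r; exact: He.
apply: ((compact_near_coveringP K).1 cK R ((0 : R)^'+)
    (fun e x => forall a : multi_index d,
      (mdeg a <= l)%N -> normc (mpartial a (f e) x) <= e ^+ p)) => x Kx.
have := KU x Kx; rewrite -WU => -[i _ Wx].
have /nbhs_ballP[r /= r0 Hr] := open_nbhs_nbhs (conj (oW i) Wx).
have r20 : 0 < r / 2 by rewrite divr_gt0.
have BW : [set z : E | `|x - z| <= r / 2] `<=` W i.
  move=> z /= xz; apply: Hr; rewrite -ball_normE /=; apply: (le_lt_trans xz).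
  by move: r0; clear; lra.
have nn := negligible_elim l p (nW i) (@closed_ball_norm_compact x (r / 2)) BW.
exists (ball x (r / 2), [set e | forall a z, (mdeg a <= l)%N ->
   [set z : E | `|x - z| <= r / 2] z -> normc (mpartial a (f e) z) <= e ^+ p]).
  by split => /=; [exact: nbhsx_ballx|exact: nn].
move=> [z e] /= [xz He] a al; apply: He => //.
by move: xz; rewrite -ball_normE /= => /ltW.
Qed.

Lemma coset_eq U f g : open U -> negligible U (fun e x => f e x - g e x) ->
  coset U f = coset U g.
Proof.
move=> oU nfg; apply/seteqP; split => h /= nh.
  have := negligibleB oU nh (negligible_sym oU nfg).
  congr negligible; apply/funext => e; apply/funext => x.
  by rewrite opprB addrA subrK.
have := negligibleB oU nh nfg.
congr negligible; apply/funext => e; apply/funext => x.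
by rewrite opprB addrA subrK.
Qed.

(** The class of a net is a function of its coset alone, moderate or not. *)
Lemma colombeau_class_eq U f g : open U -> negligible U (fun e x => f e x - g e x) ->
  colombeau_class U f = colombeau_class U g.
Proof. by move=> oU nfg; rewrite /colombeau_class (coset_eq oU nfg). Qed.

Lemma colombeau_ext U (G H : colombeau U) : G = H :> set net -> G = H.
Proof.
case: G H => A PA [B PB] /= AB; subst B; congr ColombeauElement.
exact: Prop_irrelevance.
Qed.

Lemma colombeau_classE U f : moderate U f ->
  colombeau_class U f = coset U f :> set net.
Proof.
move=> mf; have ex : exists2 g, moderate U g & coset U f = coset U g by exists f.
exact: (@xgetPex _ (colombeau0 U) [set G : colombeau U | G = coset U f :> set net]
  (ex_intro _ (ColombeauElement ex) erefl)).
Qed.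

Lemma moderate_representative U (G : colombeau U) : moderate U (representative G).
Proof. by rewrite /representative; case: (cid2 _). Qed.

Lemma coset_representative U (G : colombeau U) : G = coset U (representative G) :> set net.
Proof. by rewrite /representative; case: (cid2 _) => f _ /= e. Qed.

(** Moderateness rules out the default value of the class. *)
Lemma colombeau_class_inj U f g : moderate U f -> moderate U g ->
  colombeau_class U f = colombeau_class U g -> negligible U (fun e x => f e x - g e x).
Proof.
move=> mf mg e.
have fg : coset U f = coset U g by rewrite -(colombeau_classE mf) -(colombeau_classE mg) e.
have : coset U f f by exact: negligible_refl.
by rewrite fg.
Qed.

(** Restriction is defined through an arbitrary representative; it differs from f by
    a negligible net. *)
Lemma colombeau_restr_class U V f : open U -> open V -> V `<=` U -> moderate U f ->
  colombeau_restr V (colombeau_class U f) = colombeau_class V f.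
Proof.
move=> oU oV VU mf; rewrite /colombeau_restr; apply: colombeau_class_eq => //.
apply: (negligible_subset VU); apply: negligible_sym => //.
have : coset U f f by exact: negligible_refl.
by rewrite -(colombeau_classE mf) coset_representative.
Qed.

(** The uniqueness half of the sheaf property. *)
Lemma colombeau_separated U (L : Type) (W : L -> set E) (G H : colombeau U) :
  open U -> (forall l, open (W l)) -> \bigcup_l W l = U ->
  (forall l, colombeau_restr (W l) G = colombeau_restr (W l) H) -> G = H.
Proof.
move=> oU oW WU GH; apply: colombeau_ext.
rewrite coset_representative [RHS]coset_representative; apply: coset_eq => //.
apply: (negligible_cover oW WU) => l; apply: colombeau_class_inj (GH l).
- apply: moderate_subset (moderate_representative G) => x Wx; rewrite -WU.
  by exists l.
- apply: moderate_subset (moderate_representative H) => x Wx; rewrite -WU.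
  by exists l.
Qed.

End Quotient.

(** * Comparison of the embeddings *)

Section Comparison.
Context {R : realType} {d : nat}.
Local Notation E := 'rV[R]_d.
Local Notation C := R[i].
Local Notation negligible := Defs.negligible.
Local Notation normc := Normc.normc.
Context (Omega : set E) (rho chi : E -> C) (kappa : R -> E -> C).
Context (oO : open Omega) (Hrho : schwartz rho) (Hchi : plateau chi).
Context (Hkappa : exhaustion_cutoffs Omega kappa).
Implicit Types (T : schwartz_distribution Omega) (K W V : set E) (k : E -> C).

Let S_net T : net (R := R) (d := d) :=
  fun e => convolution (cutoff (kappa e) T) (theta_eps rho chi e).
Let A_net k T : net (R := R) (d := d) :=
  fun e => convolution (cutoff k T) (rho_eps rho e).

Let schi : smooth setT chi. Proof. by have [[]] := Hchi. Qed.

Lemma smooth_S_net T U : smooth_net U (S_net T).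
Proof.
move=> e He; apply: (@smooth_subset _ _ _ setT) => //.
apply: smooth_convolution; last exact: smooth_theta_eps e Hrho.1 schi.
by have [] := Hkappa He.
Qed.

Lemma smooth_A_net k T U : testfun Omega k -> smooth_net U (A_net k T).
Proof.
move=> tk e He; apply: (@smooth_subset _ _ _ setT) => //.
exact: smooth_convolution tk (smooth_rho_eps e Hrho.1).
Qed.

Lemma moderate_A_net k T U : testfun Omega k -> moderate U (A_net k T).
Proof.
move=> tk; apply: moderate_intro; first exact: smooth_A_net.
move=> l K _ _; have [M [q [M0 HM]]] := convolution_rho_moderate T l Hrho tk.
exists M, q; apply: filterS near_unit_interval => e He a x al _.
by have [s ss ->] := mpartialE a (A_net k T e); apply: HM; rewrite ?ss.
Qed.

(** Near K the net differs by a bounded one from a convolution with a fixed cut-off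
    distribution, where the cutoff may be taken from the family kappa itself. *)
Lemma moderate_S_net T : moderate Omega (S_net T).
Proof.
apply: moderate_intro; first exact: smooth_S_net.
move=> l K cK KO.
have [r /andP[r0 r1] Hr] := cutoffs_eventually_one oO Hkappa cK KO.
have [tk _ _] := Hkappa (introT andP (conj r0 r1)).
have k1 x z : K x -> ball x r z -> kappa r z = 1.
  by move=> Kx xz; apply: (Hr x) => //; rewrite r0 /=.
have [M M0 HM] := theta_rho_difference T l 0 oO Hrho Hchi Hkappa cK KO tk r0 k1.
have [M' [q [M'0 HM']]] := convolution_rho_moderate T l Hrho tk.
exists (M + M'), q.
apply: filterS2 near_unit_interval HM => e He HMe a x al Kx.
have [s ss ->] := mpartialE a (S_net T e).
have sl : (size s <= l)%N by rewrite ss.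
have -> : cpartials s (S_net T e) x =
    cpartials s (fun x => S_net T e x - A_net (kappa r) T e x) x +
    cpartials s (A_net (kappa r) T e) x.
  rewrite (cpartialsB s openT (smooth_S_net T (U := setT) He)
    (smooth_A_net T (U := setT) tk He))//.
  by rewrite subrK.
apply: (le_trans (normcD_le _ _)); rewrite mulrDl; apply: lerD; last exact: HM'.
apply: (le_trans (HMe s x sl Kx)); rewrite expr0; apply: ler_wpM2l => //.
have /andP[e0 e1] := He.
by rewrite invf_ge1 ?exprn_gt0// exprn_ile1// ltW.
Qed.

Lemma negligible_S_A W V k T : open W -> open V -> closure W `<=` Omega ->
  closure W `<=` V -> testfun Omega k -> (forall x, V x -> k x = 1) ->
  negligible W (fun e x => S_net T e x - A_net k T e x).
Proof.
move=> oW oV WO WV tk k1; apply: negligible_intro.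
  apply: smooth_netB => //; [exact: smooth_S_net|exact: smooth_A_net].
move=> l K p cK KW.
have Kcl : K `<=` closure W by move=> x /KW; exact: subset_closure.
have KO := subset_trans Kcl WO; have KV := subset_trans Kcl WV.
have [r r0 Hr] : exists2 r : R, 0 < r &
    forall x e z, K x -> 0 < e <= r -> ball x r z -> k z = 1.
  apply: (@compact_uniform_radius _ _ K (fun _ z => k z = 1) cK) => x Kx.
  have /nbhs_ballP[r /= r0 Hr] := open_nbhs_nbhs (conj oV (KV x Kx)).
  by exists r => // _ z _ /Hr; exact: k1.
have kK x z : K x -> ball x r z -> k z = 1.
  by move=> Kx; apply: (Hr x r) => //; rewrite r0 lexx.
have [M M0 HM] := theta_rho_difference T l p oO Hrho Hchi Hkappa cK KO tk r0 kK.
exists M; apply: filterS HM => e HMe a x al Kx.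
have [s ss ->] := mpartialE a (fun x => S_net T e x - A_net k T e x).
by apply: HMe; rewrite ?ss.
Qed.

(** Eventually the two nets agree around K. *)
Lemma negligible_S_local W (e0 : R) T : open W -> closure W `<=` Omega ->
  admissible_eps Omega rho chi W e0 ->
  negligible W (fun e x => S_net T e x -
    convolution T (theta_eps rho chi (if e <= e0 ^+ 2 then e else e0 ^+ 2)) x).
Proof.
move=> oW WO [/andP[e00 e01] Hadm].
have e02 : 0 < e0 ^+ 2 < 1 by rewrite exprn_gt0//= exprn_ilt1// ltW.
apply: negligible_intro.
  apply: smooth_netB => //; first exact: smooth_S_net.
  move=> e /andP[e_gt0 e_le1].
  rewrite /=; set e' := if _ then _ else _.
  have He' : 0 < e' <= e0 ^+ 2.
    rewrite /e'; case: ifP => [ee0|_]; first by rewrite e_gt0.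
    by rewrite lexx andbT; case/andP: e02.
  have e'1 : 0 < e' < 1.
    have /andP[-> /= e'e0] := He'; apply: le_lt_trans e'e0 _.
    by case/andP: e02.
  exact: (smooth_pairing_theta T oO Hrho Hchi Hkappa oW e'1
    (fun x Wx => Hadm x e' Wx He')).
move=> l K p cK KW.
have KO : K `<=` Omega by move=> x /KW /subset_closure; exact: WO.
have [r /andP[r0 r1] Hr] := cutoffs_eventually_one oO Hkappa cK KO.
have r20 : 0 < r / 2 by rewrite divr_gt0.
have [e1 /andP[e10 e11] He1] := theta_eps_small_support rho Hchi r20.
exists 0.
have n2 : \forall e \near (0 : R)^'+, e <= e1 by exact: nbhs_right_le.
have n3 : \forall e \near (0 : R)^'+, e <= r by exact: nbhs_right_le.
have n4 : \forall e \near (0 : R)^'+, e <= e0 ^+ 2.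
  by apply: nbhs_right_le; case/andP: e02.
apply: filterS (filterI (filterI near_unit_interval n2) (filterI n3 n4)).
move=> e [[/andP[e_gt0 _] ee1] [er ee0]] a x al Kx.
rewrite ee0 mul0r.
have oB : open (ball x (r / 2)) by exact: ball_open.
have eqB x' : ball x (r / 2) x' ->
    S_net T e x' - convolution T (theta_eps rho chi e) x' = (fun=> 0) x'.
  move=> xx'; apply/eqP; rewrite subr_eq0; apply/eqP; symmetry.
  apply: eq_convolution_pairing => y hy; apply: (Hr x) => //; first by rewrite e_gt0.
  have x'y : ball x' (r / 2) y.
    by rewrite -ball_normE /=; apply: (He1 e) => //; rewrite e_gt0.
  by have := ball_triangle xx' x'y; rewrite -splitr.
rewrite /mpartial (eq_cpartials_open _ oB eqB (ballxx x r20)) cpartials_0.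
by rewrite Normc.normc0.
Qed.

Lemma iota_S_restr_A T W V k : open W -> open V -> closure W `<=` Omega ->
  closure W `<=` V -> testfun Omega k -> (forall x, V x -> k x = 1) ->
  colombeau_restr W (iota_S Omega rho chi kappa T) =
  colombeau_restr W (iota_0 rho (cutoff k T)).
Proof.
move=> oW oV WO WV tk k1.
have WsO : W `<=` Omega by apply: subset_trans WO; exact: subset_closure.
rewrite /iota_S /iota_0 (colombeau_restr_class oO oW WsO (moderate_S_net T)).
rewrite (colombeau_restr_class openT oW (@subsetT _ W) (moderate_A_net T setT tk)).
apply: colombeau_class_eq => //.
exact: negligible_S_A WO WV tk k1.
Qed.

Lemma iota_S_restr_local T W (e0 : R) : open W -> closure W `<=` Omega ->
  admissible_eps Omega rho chi W e0 ->
  colombeau_restr W (iota_S Omega rho chi kappa T) = iota_local rho chi W e0 T.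
Proof.
move=> oW WO Hadm.
have WsO : W `<=` Omega by apply: subset_trans WO; exact: subset_closure.
rewrite /iota_S /iota_local (colombeau_restr_class oO oW WsO (moderate_S_net T)).
apply: colombeau_class_eq => //; exact: negligible_S_local.
Qed.

End Comparison.

(** A map with prescribed restrictions to an open cover is unique, so exhibiting one
    identifies the map chosen in the definition. *)
Lemma xget_glued {R : realType} {d : nat} (Omega : set 'rV[R]_d) (L X : Type)
    (W : L -> set 'rV[R]_d) (piece : forall l, X -> colombeau (W l))
    (iota : X -> colombeau Omega) :
  open Omega -> relatively_compact_cover Omega W ->
  (forall l T, colombeau_restr (W l) (iota T) = piece l T) ->
  xget (fun=> colombeau0 Omega) [set iota : X -> colombeau Omega |
      forall l T, colombeau_restr (W l) (iota T) = piece l T] = iota.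
Proof.
move=> oO [oW WO _ _] Hiota; apply: xget_unique => // iota' Hiota'.
apply/funext => T; apply: (colombeau_separated oO oW WO) => l.
by rewrite Hiota Hiota'.
Qed.

Theorem proposition16 (R : realType) (d : nat) (Omega : set 'rV[R]_d)
    (rho chi : 'rV[R]_d -> R[i])
    (LA : Type) (WA : LA -> set 'rV[R]_d) (psi : LA -> 'rV[R]_d -> R[i])
    (kappa : R -> 'rV[R]_d -> R[i])
    (LS : Type) (WS : LS -> set 'rV[R]_d) (e0 : LS -> R) :
  (0 < d)%N -> open Omega ->
  schwartz rho -> even_function rho -> unit_mean_vanishing_moments rho ->
  plateau chi ->
  relatively_compact_cover Omega WA -> cover_cutoffs Omega WA psi ->
  exhaustion_cutoffs Omega kappa ->
  relatively_compact_cover Omega WS ->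
  (forall l, admissible_eps Omega rho chi (WS l) (e0 l)) ->
  iota_A Omega rho WA psi = iota_S Omega rho chi kappa /\
  iota_S Omega rho chi kappa = iota_S' Omega rho chi WS e0.
Proof.
move=> _ oO Hrho _ _ Hchi HWA Hpsi Hkappa HWS Hadm; split.
- apply: (xget_glued oO HWA) => l T.
  have [oW _ _ /(_ l)[_ WO]] := HWA.
  have [tpsi _ [V [oV WV V1]]] := Hpsi l.
  exact: (iota_S_restr_A oO Hrho Hchi Hkappa T (oW l) oV WO WV tpsi V1).
- symmetry; apply: (xget_glued oO HWS) => l T.
  have [oW _ _ /(_ l)[_ WO]] := HWS.
  exact: (iota_S_restr_local oO Hrho Hchi Hkappa T (oW l) WO (Hadm l)).
Qed.
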